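(* Let $n\ge1$ and $D,V>0$. The number of diffeomorphism classes of compact Heisenberg manifolds $\Gamma\backslash\mathbb{H}_n$ which carry a left invariant (bracket generating) sub-Riemannian metric $(\mathfrak{v},\langle\cdot,\cdot\rangle)$ of corank $1$ satisfying (1) $\mathrm{diam}(\Gamma\backslash \mathbb{H}_n,\mathfrak{v},\langle\cdot,\cdot\rangle)\leq D$, (2) $\mathrm{meas}(\Gamma\backslash \mathbb{H}_n,\mathfrak{v},\langle\cdot,\cdot\rangle)\geq V$, where $\mathrm{meas}$ is the total Popp measure, is finite.
   Context: The Heisenberg Lie group $\mathbb{H}_n$ is $\mathbb{C}^n\times\mathbb{R}$ with product $(\mathbf{w},z)\cdot(\mathbf{w}',z')=(\mathbf{w}+\mathbf{w}',\,z+z'+\tfrac12\,\mathrm{Im}(\mathbf{w}\cdot\mathbf{w}'))$, where $\mathrm{Im}(\mathbf{w}\cdot\mathbf{w}')=\sum_i(x_iy_i'-y_ix_i')$ for $\mathbf w=(x_i+\sqrt{-1}\,y_i)_i$, $\mathbf w'=(x'_i+\sqrt{-1}\,y'_i)_i$; its Lie algebra is $\mathfrak{h}_n$. A compact Heisenberg manifold is a quotient $\Gamma\backslash\mathbb{H}_n$ with $\Gamma<\mathbb{H}_n$ a lattice. A left invariant sub-Riemannian metric on $\mathbb{H}_n$ is a pair $(\mathfrak{v},\langle\cdot,\cdot\rangle)$ with $\mathfrak{v}\subset\mathfrak{h}_n$ a subspace and $\langle\cdot,\cdot\rangle$ a scalar product on $\mathfrak{v}$, extended to a left invariant distribution and fibre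 metric by left translation. Its corank is $\dim(\mathfrak{h}_n/\mathfrak{v})$. It is bracket generating if iterated brackets of $\mathfrak{v}$ span $\mathfrak{h}_n$. The distance $dist(x,y)$ is the infimum of the lengths $\int_0^1\sqrt{\langle\dot c,\dot c\rangle}\,dt$ of absolutely continuous paths $c$ from $x$ to $y$ tangent a.e. to the distribution. A sub-Riemannian metric on $\Gamma\backslash\mathbb{H}_n$ is left invariant if its pullback to $\mathbb{H}_n$ is left invariant; the quotient carries the induced metric and distance. Popp's volume (corank $1$): if $U_1,\dots,U_{2n}$ is a left invariant orthonormal frame of $\mathfrak{v}$, completed by a left invariant field $U_{2n+1}$ to a frame with dual coframe $\nu^1,\dots,\nu^{2n+1}$, and $c_{ij}$ is the $U_{2n+1}$-component of $[U_i,U_j]$, then $\mathrm{dvol}_{sR}=\big(\sum_{i,j=1}^{2n}c_{ij}^2\big)^{-1/2}\,\nu^1\wedge\cdots\wedge\nu^{2n+1}$ (up to sign, independent of choices). The total Popp measure is $\left|\int_{\Gamma\backslash\mathbb{H}_n}\mathrm{dvol}_{sR}\right|$. *)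

(* Defs.v *)
From HB Require Import structures.
From mathcomp Require Import all_boot all_order all_algebra generic_quotient.
From mathcomp Require Import ring.
From mathcomp Require Import all_classical all_reals all_analysis.
Set Implicit Arguments.
Unset Strict Implicit.
Unset Printing Implicit Defensive.
Import Order.TTheory GRing.Theory Num.Theory.
Import numFieldNormedType.Exports.
Local Open Scope classical_set_scope.
Local Open Scope ring_scope.
Local Open Scope quotient_scope.

Section Lebesgue.
Variable R : realType.
Local Notation RM := (measurableTypeR R).

Definition cons_tuple N (p : RM * N.-tuple RM) : N.+1.-tuple RM :=
  [tuple of p.1 :: p.2].

Lemma measurable_cons_tuple N : measurable_fun setT (@cons_tuple N).
Proof. exact: measurable_cons. Qed.

Definition uncons_tuple N (t : N.+1.-tuple RM) : RM * N.-tuple RM :=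
  (thead t, [tuple of behead t]).

Lemma measurable_uncons_tuple N : measurable_fun setT (@uncons_tuple N).
Proof.
apply/measurable_fun_pairP; split; first exact: measurable_tnth.
exact: measurable_behead.
Qed.

Section step.
Variables (N : nat) (m : {sigma_finite_measure set (N.-tuple RM) -> \bar R}).

Definition lebesgue_cons : set (N.+1.-tuple RM) -> \bar R :=
  pushforward (lebesgue_measure \x m)%E (@cons_tuple N).

Let lebesgue_cons0 : lebesgue_cons set0 = 0%E.
Proof. by rewrite /lebesgue_cons /pushforward preimage_set0 measure0. Qed.

Let lebesgue_cons_ge0 A : (0 <= lebesgue_cons A)%E.
Proof. by rewrite /lebesgue_cons /pushforward; exact: measure_ge0. Qed.

Let lebesgue_cons_sigma_additive : semi_sigma_additive lebesgue_cons.
Proof.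
move=> F mF tF mUF; rewrite /lebesgue_cons /pushforward preimage_bigcup.
apply: measure_semi_sigma_additive.
- by move=> i; rewrite -[X in measurable X]setTI; exact: measurable_cons_tuple.
- apply/trivIsetP => /= i j _ _ ij; rewrite -preimage_setI.
  by move/trivIsetP : tF => /(_ _ _ _ _ ij) ->//; rewrite preimage_set0.
- rewrite -preimage_bigcup -[X in measurable X]setTI.
  exact: measurable_cons_tuple.
Qed.

HB.instance Definition _ := isMeasure.Build _ _ _ lebesgue_cons
  lebesgue_cons0 lebesgue_cons_ge0 lebesgue_cons_sigma_additive.

Let lebesgue_cons_sigma_finite : sigma_finite setT lebesgue_cons.
Proof.
have /sigma_finiteP[F [TF ndF Foo]] := sigma_finiteT (@lebesgue_measure R).
have /sigma_finiteP[G [TG ndG Goo]] := sigma_finiteT m.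
exists (fun k => @uncons_tuple N @^-1` (F k `*` G k)).
  apply/seteqP; split=> // t _.
  have [i _ Fi] : (\bigcup_k F k) (thead t) by rewrite -TF.
  have [j _ Gj] : (\bigcup_k G k) [tuple of behead t] by rewrite -TG.
  exists (maxn i j) => //; split.
    by move: Fi; exact/subsetPset/ndF/leq_maxl.
  by move: Gj; exact/subsetPset/ndG/leq_maxr.
move=> k; have [mF Fk] := Foo k; have [mG Gk] := Goo k.
have mFG : measurable (F k `*` G k) by exact: measurableX.
split.
  by rewrite -[X in measurable X]setTI; exact: measurable_uncons_tuple.
rewrite /lebesgue_cons /pushforward -comp_preimage.
rewrite [X in X @^-1` _](_ : _ = id); last first.
  by apply/funext => -[x t]; congr pair; apply/val_inj.
by rewrite preimage_id product_measure1E// lte_mul_pinfty// ge0_fin_numE.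
Qed.

HB.instance Definition _ := Measure_isSigmaFinite.Build _ _ _ lebesgue_cons
  lebesgue_cons_sigma_finite.

End step.

(* Lebesgue measure on R^N, N.-tuple R with the product sigma-algebra, as the
   N-fold product of the one-dimensional Lebesgue measure. *)
Fixpoint lebesgueN N : {sigma_finite_measure set (N.-tuple RM) -> \bar R} :=
  match N with
  | 0 => \d_([tuple] : 0.-tuple RM)
  | N'.+1 => lebesgue_cons (lebesgueN N')
  end.

Definition row_of_tuple N (t : N.-tuple RM) : 'rV[R]_N := \row_i tnth t i.

End Lebesgue.

Section Smooth.
Variables (R : realType) (V W : normedModType R).

Definition iter_derive (vs : seq V) (f : V -> W) : V -> W :=
  foldr (fun v g => 'D_v g) f vs.

(* C^oo on U (used with U open): all iterated directional derivatives exist and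
   are continuous at the points of U. *)
Definition smooth_on (U : set V) (f : V -> W) :=
  forall (vs : seq V) (p : V), U p ->
    {for p, continuous (iter_derive vs f)} /\
    forall v, derivable (iter_derive vs f) p v.

End Smooth.

(* Absolute continuity on [a, b]; the intervals of s are nonoverlapping. *)
Definition abs_continuous (R : realType) (V : normedModType R) (a b : R)
    (c : R -> V) :=
  forall e : R, 0 < e -> exists2 d : R, 0 < d &
    forall s : seq (R * R),
      all (fun I => (a <= I.1) && (I.1 <= I.2) && (I.2 <= b)) s ->
      pairwise (fun I J => (I.2 <= J.1) || (J.2 <= I.1)) s ->
      \sum_(I <- s) (I.2 - I.1) < d ->
      \sum_(I <- s) `|c I.2 - c I.1| < e.

(* The point (x + i y, z) of C^n x R is the row vector (x | y | z); the same
   vector space is used for the Lie algebra, as the tangent space at 0. *)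
Notation heis R n := 'rV[R]_(n + n + 1).

Section Heisenberg.
Variables (R : realType) (n : nat).
Local Notation H := (heis R n).

Definition hx (p : H) : 'rV[R]_n := lsubmx (lsubmx p).
Definition hy (p : H) : 'rV[R]_n := rsubmx (lsubmx p).
Definition hz (p : H) : R := rsubmx p 0 0.

(* Im(w . w') in the sign convention sum_i (x_i y'_i - y_i x'_i). *)
Definition symp (p q : H) : R :=
  \sum_(i < n) (hx p 0 i * hy q 0 i - hy p 0 i * hx q 0 i).

Definition hmul (p q : H) : H :=
  row_mx (row_mx (hx p + hx q) (hy p + hy q))
         (hz p + hz q + 2^-1 * symp p q)%:M.

Definition hinv (p : H) : H := - p.

Lemma hxE p q : hx (hmul p q) = hx p + hx q.
Proof. by rewrite /hx /hmul !row_mxKl. Qed.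

Lemma hyE p q : hy (hmul p q) = hy p + hy q.
Proof. by rewrite /hy /hmul row_mxKl row_mxKr. Qed.

Lemma hzE p q : hz (hmul p q) = hz p + hz q + 2^-1 * symp p q.
Proof. by rewrite /hz /hmul row_mxKr mxE eqxx mulr1n. Qed.

Lemma heisP p q : hx p = hx q -> hy p = hy q -> hz p = hz q -> p = q.
Proof.
rewrite /hx /hy /hz => ex ey ez.
rewrite -[p]hsubmxK -[q]hsubmxK -[lsubmx p]hsubmxK -[lsubmx q]hsubmxK ex ey.
by congr row_mx; apply/matrixP => i j; rewrite !ord1.
Qed.

Lemma symp_hmull p q r : symp (hmul p q) r = symp p r + symp q r.
Proof.
rewrite /symp -big_split/=; apply: eq_bigr => i _.
by rewrite hxE hyE !mxE; ring.
Qed.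

Lemma symp_hmulr p q r : symp p (hmul q r) = symp p q + symp p r.
Proof.
rewrite /symp -big_split/=; apply: eq_bigr => i _.
by rewrite hxE hyE !mxE; ring.
Qed.

Lemma hmulA : associative hmul.
Proof.
move=> p q r; apply: heisP; rewrite ?hxE ?hyE ?addrA// !hzE.
by rewrite symp_hmull symp_hmulr; ring.
Qed.

Lemma hmul0p : left_id 0 hmul.
Proof.
move=> p; apply: heisP; rewrite ?(hxE, hyE, hzE) /hx /hy /hz ?raddf0 ?add0r//.
rewrite mxE add0r [X in _ + _ * X]big1 ?mulr0 ?addr0// => i _.
by rewrite /hx /hy !raddf0 !mxE !mul0r subr0.
Qed.

Lemma hmulVp : left_inverse 0 hinv hmul.
Proof.
move=> p; apply: heisP; rewrite ?(hxE, hyE, hzE) /hinv.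
- by rewrite /hx !raddfN/= addNr !raddf0.
- by rewrite /hy !raddfN/= addNr !raddf0.
- rewrite /hz !raddfN/= !mxE addNr add0r [X in _ * X]big1 ?mulr0// => i _.
  by rewrite /hx /hy !raddfN/= !mxE; ring.
Qed.

(* The left invariant vector field d(L_p)_0 u. *)
Definition left_field (u p : H) : H := 'D_u (hmul p) 0.

Definition vf_bracket (X Y : H -> H) (p : H) : H :=
  'D_(X p) Y p - 'D_(Y p) X p.

Definition lie_bracket (u w : H) : H :=
  vf_bracket (left_field u) (left_field w) 0.

(* d(L_{p^-1})_p X: it identifies a tangent vector at p with an element of the
   Lie algebra, inversely to u |-> left_field u p. *)
Definition maurer_cartan (p X : H) : H := 'D_X (hmul (hinv p)) p.

Lemma derive_affine (f : H -> H) (p v d : H) :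
  (forall h : R, f (h *: v + p) = h *: d + f p) -> 'D_v f p = d.
Proof.
move=> fE; apply: cvg_lim => //; apply: cvg_near_cst.
near=> h; rewrite /= fE addrK scalerA mulVf ?scale1r//.
by near: h; exact: nbhs_dnbhs_neq.
Unshelve. all: by end_near. Qed.

Lemma symp_linear p (a : R) u w : symp p (a *: u + w) = a * symp p u + symp p w.
Proof.
rewrite /symp mulr_sumr -big_split/=; apply: eq_bigr => i _.
by rewrite /hx /hy !linearP/= !mxE; ring.
Qed.

Lemma sympC p q : symp q p = - symp p q.
Proof. by rewrite /symp -sumrN; apply: eq_bigr => i _; ring. Qed.

Lemma sympNl p q : symp (- p) q = - symp p q.
Proof.
rewrite /symp -sumrN; apply: eq_bigr => i _.
by rewrite /hx /hy !raddfN/= !mxE; ring.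
Qed.

Lemma symp0l p : symp 0 p = 0.
Proof.
by rewrite /symp big1// => i _; rewrite /hx /hy !raddf0 !mxE !mul0r subr0.
Qed.

Lemma hmul_affine p q u (h : R) : hmul p (h *: u + q) =
  h *: (u + row_mx 0 (2^-1 * symp p u)%:M) + hmul p q.
Proof.
have lx a v w : hx (a *: v + w) = a *: hx v + hx w by rewrite /hx !linearP.
have ly a v w : hy (a *: v + w) = a *: hy v + hy w by rewrite /hy !linearP.
have lz a v w : hz (a *: v + w) = a * hz v + hz w.
  by rewrite /hz linearP/= mxE mxE.
have row0 c : [/\ hx (row_mx 0 c%:M) = 0, hy (row_mx 0 c%:M) = 0 &
                  hz (row_mx 0 c%:M) = c].
  rewrite /hx /hy /hz row_mxKl row_mxKr !raddf0; split => //.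
  by rewrite mxE eqxx mulr1n.
have [x0 y0 z0] := row0 (2^-1 * symp p u).
apply: heisP; rewrite -[u + _]scale1r !(scalerDr, scale1r) -addrA ?lx ?ly ?lz.
- by rewrite x0 !hxE lx scaler0 add0r addrCA.
- by rewrite y0 !hyE ly scaler0 add0r addrCA.
- by rewrite z0 !hzE lz symp_linear; ring.
Qed.

Lemma left_fieldE u p : left_field u p = u + row_mx 0 (2^-1 * symp p u)%:M.
Proof. by apply: derive_affine => h; rewrite hmul_affine. Qed.

Lemma maurer_cartanE p X :
  maurer_cartan p X = X - row_mx 0 (2^-1 * symp p X)%:M.
Proof.
apply: derive_affine => h; rewrite hmul_affine sympNl mulrN.
by rewrite opp_row_mx oppr0 -raddfN.
Qed.

Lemma lie_bracketE u w : lie_bracket u w = row_mx 0 (symp u w)%:M.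
Proof.
have left0 v : left_field v 0 = v.
  by rewrite left_fieldE symp0l mulr0 raddf0 row_mx0 addr0.
have dleft x y : 'D_x (left_field y) 0 = row_mx 0 (2^-1 * symp x y)%:M.
  apply: derive_affine => h; rewrite !left_fieldE addr0 symp0l mulr0.
  have -> : symp (h *: x) y = h * symp x y.
    rewrite sympC -[h *: x]addr0 symp_linear [symp y x]sympC [symp y 0]sympC.
    by rewrite symp0l oppr0 addr0 mulrN opprK.
  rewrite raddf0 row_mx0 addr0 addrC scale_row_mx scaler0 scale_scalar_mx.
  by rewrite mulrCA.
rewrite /lie_bracket /vf_bracket left0 left0.
rewrite [X in X - _]dleft [X in _ - X]dleft [symp w u]sympC.
rewrite opp_row_mx add_row_mx subr0 -raddfB/=; congr (row_mx _ _%:M).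
by field.
Qed.

Record subgroup := Subgroup {
  subgroup_set :> set H;
  subgroup1 : subgroup_set 0;
  subgroupM : forall p q,
    subgroup_set p -> subgroup_set q -> subgroup_set (hmul p q);
  subgroupV : forall p, subgroup_set p -> subgroup_set (hinv p) }.

Section quotient.
Variable Gamma : subgroup.

(* The left action of Gamma: the classes are the orbits Gamma p. *)
Definition coset_rel : rel H :=
  fun p q => `[< exists2 g, subgroup_set Gamma g & q = hmul g p >].

Lemma coset_rel_refl : reflexive coset_rel.
Proof.
by move=> p; apply/asboolP; exists 0; [exact: subgroup1|rewrite hmul0p].
Qed.

Let coset_rel_sub p q : coset_rel p q -> coset_rel q p.
Proof.
move=> /asboolP[g Gg ->]; apply/asboolP; exists (hinv g).
  exact: subgroupV.
by rewrite hmulA hmulVp hmul0p.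
Qed.

Lemma coset_rel_sym : symmetric coset_rel.
Proof. by move=> p q; apply/idP/idP; exact: coset_rel_sub. Qed.

Lemma coset_rel_trans : transitive coset_rel.
Proof.
move=> q p r /asboolP[g Gg ->] /asboolP[h Gh ->]; apply/asboolP.
by exists (hmul h g); [exact: subgroupM|rewrite hmulA].
Qed.

Canonical coset_equiv :=
  EquivRel coset_rel coset_rel_refl coset_rel_sym coset_rel_trans.

Definition heis_quot := {eq_quot coset_equiv}.

HB.instance Definition _ := Topological.copy heis_quot
  (quotient_topology heis_quot).
HB.instance Definition _ := Quotient.on heis_quot.

End quotient.

Record lattice := Lattice {
  lattice_group :> subgroup;
  lattice_discrete : lattice_group `<=` isolated lattice_group;
  lattice_cocompact : compact [set: heis_quot lattice_group] }.

(* The projection onto Gamma\H_n is a local diffeomorphism, hence its local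
   sections are charts of the quotient: a map between quotients is smooth iff it
   is given around each point by a smooth map between the groups. *)
Definition smooth_quot (Gamma Gamma' : subgroup)
    (f : heis_quot Gamma -> heis_quot Gamma') :=
  forall p : H, exists (U : set H) (F : H -> H),
    [/\ open_nbhs p U, smooth_on U F &
        forall q, U q -> f (\pi_(heis_quot Gamma) q) = \pi_(heis_quot Gamma') (F q)].

Definition diffeomorphic (Gamma Gamma' : subgroup) :=
  exists (f : heis_quot Gamma -> heis_quot Gamma')
         (g : heis_quot Gamma' -> heis_quot Gamma),
    [/\ cancel f g, cancel g f, smooth_quot f & smooth_quot g].

Definition diffeo_class (Gamma : lattice) : set lattice :=
  [set Gamma' | diffeomorphic Gamma Gamma'].

(* sr_ip is the scalar product of sr_space; its values elsewhere are junk. *)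
Record sr_metric := SRMetric {
  sr_space : {vspace H};
  sr_ip : H -> H -> R;
  sr_ipC : {in sr_space &, forall u w, sr_ip u w = sr_ip w u};
  sr_ip_linear : {in sr_space & &, forall u u' w (a : R),
    sr_ip (a *: u + u') w = a * sr_ip u w + sr_ip u' w};
  sr_ip_gt0 : {in sr_space, forall u, u != 0 -> 0 < sr_ip u u} }.

Definition corank (M : sr_metric) : nat :=
  (\dim {: H}%VS - \dim (sr_space M))%N.

Inductive iter_bracket (v : {vspace H}) : H -> Prop :=
| iter_bracket_base u : u \in v -> iter_bracket v u
| iter_bracket_step u w :
    u \in v -> iter_bracket v w -> iter_bracket v (lie_bracket u w).

Definition bracket_generating (M : sr_metric) :=
  forall W : {vspace H},
    (forall u, iter_bracket (sr_space M) u -> u \in W) -> W = {: H}%VS.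

Definition velocity (c : R -> H) (t : R) : H := maurer_cartan (c t) (derive1 c t).

Definition horizontal (M : sr_metric) (c : R -> H) :=
  abs_continuous 0 1 c /\
  {ae lebesgue_measure, forall t : R, t \in `[0, 1] ->
     derivable c t 1 /\ velocity c t \in sr_space M}.

Definition sr_length (M : sr_metric) (c : R -> H) : \bar R :=
  (\int[lebesgue_measure]_(t in `[0%R, 1%R])
     (Num.sqrt (sr_ip M (velocity c t) (velocity c t)))%:E)%E.

(* A path of Gamma\H_n is the projection of a path of H_n of the same length,
   hence the infimum over the paths of H_n joining the two orbits. *)
Definition sr_dist (M : sr_metric) (Gamma : subgroup)
    (x y : heis_quot Gamma) : \bar R :=
  ereal_inf [set sr_length M c | c in
    [set c | [/\ horizontal M c, \pi_(heis_quot Gamma) (c 0) = x &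
                  \pi_(heis_quot Gamma) (c 1) = y]]].

Definition sr_diam (M : sr_metric) (Gamma : subgroup) : \bar R :=
  ereal_sup [set sr_dist M xy.1 xy.2 |
    xy in [set: heis_quot Gamma * heis_quot Gamma]].

(* The first 2n vectors are an orthonormal frame of the distribution, the last
   one completes it to a frame of the Lie algebra. *)
Definition adapted_frame (M : sr_metric) (U : (n + n + 1).-tuple H) :=
  [/\ basis_of {: H}%VS U,
      forall i : 'I_(n + n), tnth U (lshift 1 i) \in sr_space M &
      forall i j : 'I_(n + n),
        sr_ip M (tnth U (lshift 1 i)) (tnth U (lshift 1 j)) = (i == j)%:R].

Definition structure_const (U : (n + n + 1).-tuple H) (i j : 'I_(n + n)) : R :=
  coord U (rshift (n + n) ord0)
    (lie_bracket (tnth U (lshift 1 i)) (tnth U (lshift 1 j))).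

(* The density of Popp's volume form with respect to dx dy dz. The form nu^i of
   the dual coframe maps X at p to coord U i (maurer_cartan p X), and the
   determinant is nu^1 /\ ... /\ nu^(2n+1) on the coordinate frame. *)
Definition popp_density (U : (n + n + 1).-tuple H) (p : H) : R :=
  (Num.sqrt (\sum_i \sum_j structure_const U i j ^+ 2))^-1 *
  \det (\matrix_(i, j) coord U i (maurer_cartan p (delta_mx 0 j))).

(* A Borel set which meets each orbit exactly once. *)
Definition fundamental_domain (Gamma : subgroup) (F : set H) :=
  measurable (@row_of_tuple R (n + n + 1) @^-1` F) /\
  forall p : H, exists! q, F q /\ \pi_(heis_quot Gamma) q = \pi_(heis_quot Gamma) p.

Definition popp_integral (U : (n + n + 1).-tuple H) (F : set H) : \bar R :=
  (\int[lebesgueN R (n + n + 1)]_(t in @row_of_tuple R (n + n + 1) @^-1` F)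
     (popp_density U (row_of_tuple t))%:E)%E.

(* The integral over Gamma\H_n is computed on a fundamental domain F. All the
   pairs (U, F) give the same value, so that the supremum is this value. *)
Definition popp_measure (M : sr_metric) (Gamma : subgroup) : \bar R :=
  ereal_sup [set m | exists (U : (n + n + 1).-tuple H) (F : set H),
    [/\ adapted_frame M U, fundamental_domain Gamma F &
        m = `|popp_integral U F|%E]].

End Heisenberg.

(* Main.v *)
From HB Require Import structures.
From mathcomp Require Import all_boot all_order all_algebra generic_quotient.
From mathcomp Require Import ring lra.
From mathcomp Require Import all_classical all_reals all_analysis.
From mathcomp Require Import measurable_realfun.
Require Import Defs.
Set Implicit Arguments.
Unset Strict Implicit.
Unset Printing Implicit Defensive.
Import Order.TTheory GRing.Theory Num.Theory.
Import numFieldNormedType.Exports.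
Local Open Scope classical_set_scope.
Local Open Scope ring_scope.

(** Finiteness holds because a diameter bound and a lower bound on the Popp
    measure leave only finitely many choices for a lattice up to automorphisms
    of the Heisenberg group.

    Let [u_1, ..., u_2n] be an orthonormal frame of the distribution.  Since
    the distribution generates, it does not contain the central vector [Z], so
    [u_1, ..., u_2n, Z] is a basis; write [s_1, ..., s_2n, z] for its
    coordinates.  The [s_i] are additive for the group law, and along a
    horizontal path [|s_i'|] is at most the speed, so [s_i] varies by at most
    the length ([horizontal_coord_le]; for absolutely continuous paths this
    rests on [ac_increment_le_integral]).  A diameter at most [D] thus means
    that every point of the group can be moved by the lattice [Gamma] to a
    point with all [|s_i| <= l], where [l = D + 1] ([diameter_cover]).  Two
    consequences follow.

    - Elements of [Gamma] with [|s_i| <= 2 l + 1] span: a linear form in the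
      [s_i] vanishing on all of them would be contradicted by a point far away
      in the direction where the form grows ([short_vector_off]).  Choose [2n]
      independent ones, [g_1, ..., g_2n].  Some commutator of them is nontrivial
      and central, so by discreteness [Gamma] meets the center in the multiples
      of some [zeta Z] with [zeta > 0], and [symp g_i g_j = N_ij zeta] for an
      integer matrix [N] with nonzero determinant ([exists_adapted_basis]).

    - [Gamma] moves every point into the box [|s_i| <= l, |z| <= zeta], so a
      fundamental domain has at most the volume of this box
      ([lebesgue_fundamental_domain_le]).  With [W] the norm of the matrix
      [symp u_i u_j], the Popp measure is at most a constant times
      [l ^ 2n zeta / W].

    Popp measure at least [V] therefore bounds [W / zeta], and since
    [|symp g_i g_j|] is at most a constant times [(2 l + 1) ^ 2 W], it bounds
    the integers [N_ij] ([bounded_adapted_basis]).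

    It remains to see that [N] leaves finitely many classes.  In coordinates
    with respect to [g_1, ..., g_2n, zeta Z] the group law depends on [N] only,
    [Gamma] contains the vectors whose first [2n] coordinates are even integers
    and whose last coordinate is an integer, and, by integrality of commutators
    and Cramer's rule, [Gamma] lies in the grid of mesh [1 / (2 |det N|)].  So
    [Gamma] is determined by [N] and a subset of a finite grid in a box
    ([coord_codeP]).  Two lattices with the same data correspond under a linear
    automorphism of the group, which induces a diffeomorphism of the quotients
    ([same_code_isomorphic], [diffeo_class_eq]). *)

(** * Absolutely continuous functions *)

Lemma le_measure_sub d (T : measurableType d) (R : realType)
  (mu : {measure set T -> \bar R}) (A B : set T) :
  measurable A -> measurable B -> A `<=` B -> (mu A <= mu B)%E.
Proof. by move=> mA mB; apply: le_measure; rewrite inE. Qed.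

(** Compactness of the unit interval, in the form of an induction principle
    (Cousin's lemma): follow the supremum of the [t] such that [P 0 t]. *)
Lemma interval_additive_ind (R : realType) (P : R -> R -> Prop) :
  (forall a b c, 0 <= a -> a <= b -> b <= c -> c <= 1 ->
     P a b -> P b c -> P a c) ->
  (forall t, 0 <= t -> t <= 1 -> exists2 d, 0 < d &
     forall a b, 0 <= a -> a <= t -> t <= b -> b <= 1 -> b - a < d -> P a b) ->
  P 0 1.
Proof.
move=> Pcat Ploc; pose A := [set t | [/\ 0 <= t, t <= 1 & P 0 t]].
have A0 : A 0.
  have [d d0 Pd] := Ploc 0 (lexx 0) ler01.
  by split => //; apply: Pd; rewrite ?subrr.
have supA : has_sup A by split; [exists 0|exists 1 => t []].
set s := sup A.
have s0 : 0 <= s by exact: ub_le_sup (proj2 supA) _ A0.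
have s1 : s <= 1 by apply: ge_sup; [exists 0|move=> t []].
have [d d0 Pd] := Ploc s s0 s1.
have [a [a0 a1 Pa] sa] := sup_adherent (divr_gt0 d0 (ltr0n R 2)) supA.
have als : a <= s by exact: ub_le_sup (proj2 supA) _ _.
have Ps : P 0 s.
  by apply: (Pcat 0 a s) => //; apply: Pd => //; rewrite -/s in sa; lra.
pose b := Num.min 1 (s + d / 2).
have sb : s <= b by rewrite le_min s1 lerDl; lra.
have b1 : b <= 1 by rewrite ge_min lexx.
have Pb : P 0 b.
  apply: (Pcat 0 s b) => //; apply: Pd => //.
  have : b <= s + d / 2 by rewrite ge_min lexx orbT.
  lra.
have bs : b <= s.
  by apply: ub_le_sup (proj2 supA) _ _; split => //; exact: le_trans sb.
move: bs; rewrite /b ge_min => /orP[s1'|]; last by lra.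
by rewrite (@le_anti _ _ 1 s) ?s1 ?s1'.
Qed.

(** Subdivide [0, 1] into intervals that either contain a point outside [N], on
    which the hypothesis bounds the increment of [phi], or lie in an open set
    [U] of small measure around [N], on which the increments of [phi] have a
    small sum by absolute continuity. *)
Lemma ac_increment_le (R : realType) (phi G : R -> R) (N : set R) :
  abs_continuous 0 1 (phi : R -> R^o) ->
  (@lebesgue_measure R).-negligible N ->
  (forall a b, 0 <= a -> a <= b -> b <= 1 -> G a <= G b) ->
  (forall t, 0 <= t -> t <= 1 -> ~ N t -> forall e, 0 < e ->
    exists2 d, 0 < d & forall a b, 0 <= a -> a <= t -> t <= b -> b <= 1 ->
      b - a < d -> phi b - phi a <= G b - G a + e * (b - a)) ->
  phi 1 - phi 0 <= G 1 - G 0.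
Proof.
move=> acphi [N' [mN' N'0 NN']] ndG good; apply/ler_addgt0Pr => e e0.
have e20 : 0 < e / 2 by lra.
have [d d0 acd] := acphi _ e20.
have N'fin : (lebesgue_measure N' < +oo)%E by rewrite N'0.
have [U [oU NU Ud]] := lebesgue_regularity_outer mN' N'fin d0.
have mU : measurable U by exact: open_measurable.
have muU : (lebesgue_measure U < d%:E)%E.
  apply: le_lt_trans Ud; rewrite -[leRHS]adde0 -N'0.
  rewrite -measureU//; last 2 first.
  - exact: measurableD.
  - by rewrite setDE -setIA setICl setI0.
  by apply: le_measure_sub => //; [apply: measurableU => //; exact: measurableD
    |move=> x Ux; have [|] := pselect (N' x); [right|left]].
(* An interval contained in U has length M b - M a: bounding lengths by
   increments of M makes the bound on their sum additive. *)
pose E t := U `&` `]0, t]%classic.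
have mE t : measurable (E t) by apply: measurableI.
pose M t := fine (lebesgue_measure (E t)).
have Efin t : lebesgue_measure (E t) \is a fin_num.
  rewrite ge0_fin_numE//; apply: le_lt_trans (ltry d).
  apply: le_trans (ltW muU); apply: le_measure_sub; [exact: mE|by []|].
  by move=> ? [].
have ME t : lebesgue_measure (E t) = (M t)%:E by rewrite fineK.
have Mle a b : 0 <= a -> a <= b -> M a <= M b.
  move=> a0 ab; rewrite -lee_fin -!ME; apply: le_measure_sub; [exact: mE..|].
  move=> x [Ux]/=; rewrite !in_itv/= => /andP[x0 xa]; split => //=.
  by rewrite in_itv/= x0 (le_trans xa).
have Meq a b : 0 <= a -> a <= b -> `[a, b]%classic `<=` U -> b - a <= M b - M a.
  move=> a0 ab abU; rewrite lerBrDl -lee_fin EFinD -!ME.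
  have <- : lebesgue_measure `]a, b]%classic = (b - a)%:E.
    rewrite lebesgue_measure_itv/= lte_fin.
    by move: ab; rewrite le_eqVlt => /predU1P[->|->//]; rewrite ltxx subrr.
  rewrite -measureU; [|exact: mE|exact: measurable_itv|]; last first.
    apply/seteqP; split => // x [[_]]/=; rewrite !in_itv/= => /andP[_ xa].
    by move=> /andP[+ _]; rewrite ltNge xa.
  apply: le_measure_sub; [|exact: mE|].
    by apply: measurableU; [exact: mE|exact: measurable_itv].
  move=> x [[Ux]|]/=; rewrite !in_itv/= => /andP[x0 xa].
    by split => //=; rewrite in_itv/= x0 (le_trans xa).
  split; first by apply: abU; rewrite /= in_itv/= ltW.
  by rewrite /= in_itv/= xa (le_lt_trans a0).
(* s collects the intervals of the subdivision that lie in U. *)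
pose P a b := exists s : seq (R * R),
  [/\ all (fun I => (a <= I.1) && (I.1 <= I.2) && (I.2 <= b)) s,
    pairwise (fun I J => (I.2 <= J.1) || (J.2 <= I.1)) s,
    \sum_(I <- s) (I.2 - I.1) <= M b - M a &
    phi b - phi a <= G b - G a + e / 2 * (b - a)
      + \sum_(I <- s) `|phi I.2 - phi I.1|].
suff [s [s1 s2 s3 s4]] : P 0 1.
  have M0 : M 0 = 0.
    by rewrite /M (_ : E 0 = set0) ?measure0//; apply/seteqP; split => // x [_] /=;
      rewrite in_itv/= => /andP[/lt_le_trans/[apply]]; rewrite ltxx.
  have M1 : M 1 < d.
    rewrite -lte_fin -ME; apply: le_lt_trans muU; 
    by apply: le_measure_sub; [exact: mE|by []|move=> ? []].
  have := acd s s1 s2 _; rewrite M0 subr0 in s3; move=> /(_ (le_lt_trans s3 M1)).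
  by move=> s5; apply: (le_trans s4); rewrite subr0 mulr1 -addrA lerD2l; lra.
apply: interval_additive_ind => [a b c a0 ab bc c1 [s [s1 s2 s3 s4]]
    [u [u1 u2 u3 u4]]|t t0 t1].
  exists (s ++ u); rewrite all_cat pairwise_cat !big_cat/= s2 u2 !andbT; split.
  - apply/andP; split.
      by apply/allP => I /(allP s1) /andP[-> /le_trans]; apply.
    by apply/allP => I /(allP u1) /andP[/andP[+ ->] ->]; rewrite !andbT; exact: le_trans.
  - apply/allrelP => I J /(allP s1) /andP[_ Ib] /(allP u1) /andP[/andP[bJ _] _].
    by rewrite (le_trans Ib).
  - lra.
  - lra.
have [Nt|nNt] := pselect (N t).
  have /nbhs_ballP[r/= r0 rU] : nbhs t U.
    by apply: open_nbhs_nbhs; split => //; exact/NU/NN'.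
  exists r => // a b a0 a_t tb b1 bar.
  have ab : a <= b by exact: le_trans tb.
  have abU : `[a, b]%classic `<=` U.
    move=> x /=; rewrite in_itv/= => /andP[ax xb]; apply: rU.
    by rewrite /ball/= ltr_norml; apply/andP; split; lra.
  exists [:: (a, b)]; rewrite /= !big_seq1/= !lexx ab; split => //.
    exact: Meq.
  have := ndG a b a0 ab b1; have := ler_norm (phi b - phi a).
  have : 0 <= e / 2 * (b - a) by rewrite mulr_ge0 ?subr_ge0// ltW.
  lra.
have [r r0 Hr] := good t t0 t1 nNt _ e20.
exists r => // a b a0 a_t tb b1 bar; exists [::]; rewrite /= !big_nil; split => //.
  by rewrite subr_ge0 Mle// (le_trans a_t).
by rewrite addr0; exact: Hr.
Qed.

(** The integral of a nonnegative function is a supremum over the simple functions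
    below it, so it is monotone even on functions such as the speed of a
    horizontal path, which is measurable only up to a null set. *)
Lemma le_integral_ge0 d (T : measurableType d) (R : realType)
    (mu : {measure set T -> \bar R}) (D : set T) (f g : T -> \bar R) :
  (forall x, D x -> (0 <= f x)%E) -> (forall x, D x -> (f x <= g x)%E) ->
  (\int[mu]_(x in D) f x <= \int[mu]_(x in D) g x)%E.
Proof.
move=> f0 fg; have g0 x : D x -> (0 <= g x)%E.
  by move=> Dx; exact: le_trans (f0 x Dx) (fg x Dx).
rewrite !ge0_integralE//; apply: ereal_sup_le => _ [s sf <-]; exists s => // x.
apply: le_trans (sf x) _; rewrite !patchE; case: ifPn => // /set_mem.
exact: fg.
Qed.

Lemma derive_le0_increment (R : realType) (psi : R -> R) (t e : R) :
  derivable (psi : R -> R^o) t 1 -> derive1 (psi : R -> R^o) t <= 0 -> 0 < e ->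
  exists2 d, 0 < d & forall a b, a <= t -> t <= b -> b - a < d ->
    psi b - psi a <= e * (b - a).
Proof.
move=> /cvg_ex[/= l dl] l0 e0.
have {}l0 : l <= 0.
  suff <- : derive1 (psi : R -> R^o) t = l by [].
  by rewrite derive1E; apply/cvg_lim.
have /cvgrPdist_lt /(_ _ e0) /nbhs_ballP[d/= d0 Hd] := dl.
have {}Hd (h : R) : h != 0 -> `|h| < d -> h^-1 * (psi (h + t) - psi t) < e.
  move=> h0 hd; have := Hd h _ h0; rewrite /ball/= sub0r normrN => /(_ hd).
  rewrite /GRing.scale/= mulr1 ltr_norml => /andP[+ _]; lra.
exists d => // a b at_ tb bad.
have Hb : psi b - psi t <= e * (b - t).
  have [<-|bt] := eqVneq b t; first by rewrite !subrr mulr0.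
  have bt0 : 0 < b - t by rewrite subr_gt0 lt_neqAle eq_sym bt.
  have /ltW : (b - t)^-1 * (psi (b - t + t) - psi t) < e.
    by apply: Hd; rewrite ?gt_eqF// gtr0_norm//; lra.
  by rewrite subrK -(ler_pM2l bt0) mulrA mulfV ?gt_eqF// mul1r mulrC.
have Ha : psi t - psi a <= e * (t - a).
  have [->|ta] := eqVneq a t; first by rewrite !subrr mulr0.
  have ta0 : a - t < 0 by rewrite subr_lt0 lt_neqAle ta.
  have /ltW : (a - t)^-1 * (psi (a - t + t) - psi t) < e.
    by apply: Hd; rewrite ?lt_eqF// ltr0_norm//; lra.
  by rewrite subrK -(ler_nM2l ta0) mulrA mulfV ?lt_eqF// mul1r; lra.
lra.
Qed.

(** On [D] the derivative is the limit of the difference quotients with step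
    [1 / (k + 1)].  Beyond 1 nothing is known of [phi], so the quotients are
    those of its continuous extension by constants. *)
Lemma ac_measurable_derive (R : realType) (phi : R -> R) (D : set R) :
  abs_continuous 0 1 (phi : R -> R^o) -> measurable D ->
  D `<=` `]0, 1[%classic -> (forall t, D t -> derivable (phi : R -> R^o) t 1) ->
  measurable_fun D (derive1 (phi : R -> R^o)).
Proof.
move=> acphi mD D01 dphi.
pose cl (t : R) := if t < 0 then 0 else if 1 < t then 1 else t.
have cl01 t : 0 <= cl t <= 1.
  by rewrite /cl; case: ltP => h1; last case: ltP => h2; lra.
have clE t : 0 <= t -> t <= 1 -> cl t = t.
  by rewrite /cl => t0 t1; case: ltP => h1; last case: ltP => h2; lra.
have clL s t : s <= t -> cl s <= cl t <= cl s + (t - s).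
  rewrite /cl => st; case: (ltP t) => h1; last case: (ltP 1 t) => h2;
  (case: (ltP s) => h3; last case: (ltP 1 s) => h4); lra.
pose psi t := phi (cl t).
have cpsi : continuous psi.
  move=> t; apply/cvgrPdist_lt => e e0; have [d d0 Hd] := acphi e e0.
  have inc a b : a <= b -> b - a < d -> `|psi b - psi a| < e.
    move=> ab bad; have := Hd [:: (cl a, cl b)].
    rewrite /= !big_seq1/= !andbT; apply => //.
      by have := clL a b ab; have := cl01 a; have := cl01 b; lra.
    by have := clL a b ab; lra.
  apply/nbhs_ballP; exists d => //= u; rewrite /ball/= ltr_norml => /andP[h1 h2].
  by case: (leP u t) => ut; [|rewrite distrC]; apply: inc; lra.
have mpsi : measurable_fun setT psi by exact: continuous_measurable_fun.
pose f k t := (k.+1%:R : R) * (psi (t + k.+1%:R^-1) - psi t).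
apply: (@measurable_fun_cvg _ _ _ _ f) => [k|t Dt].
  apply: measurable_funTS; apply: measurable_funM => //.
  apply: measurable_funB => //; apply: measurableT_comp => //.
  exact: measurable_funD.
have /D01 := Dt; rewrite /= in_itv/= => /andP[t0 t1].
have := dphi t Dt; rewrite derive1E => /cvg_ex[l dl].
have -> : 'D_1 (phi : R -> R^o) t = l by apply/cvg_lim.
have dlk := (cvgr_dnbhsP _ _ _).1 dl (fun k => k.+1%:R^-1) _.
apply: cvg_trans (dlk _); last first.
  split; last exact: cvg_harmonic.
  by move=> k; rewrite invr_eq0.
apply: near_eq_cvg.
near=> k.
have tk : t + k.+1%:R^-1 <= 1.
  rewrite -lerBrDl; apply: ltW; near: k.
  by apply: cvgr_lt cvg_harmonic _ _; rewrite subr_gt0.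
have k0 : (0 : R) <= k.+1%:R^-1 by rewrite invr_ge0.
rewrite /f /psi !clE ?addr_ge0 ?(ltW t0) ?(ltW t1)//.
by rewrite invrK /shift/= /GRing.scale/= mulr1 [t + _]addrC.
Unshelve. all: by end_near. Qed.

(** Compare [phi] with the primitive [G] of the positive part of its derivative:
    [G] is nondecreasing and, by Lebesgue differentiation, [G - phi] has a
    nonnegative derivative almost everywhere, so [ac_increment_le] applies. *)
Lemma ac_increment_le_integral (R : realType) (phi h : R -> R) :
  abs_continuous 0 1 (phi : R -> R^o) -> (forall t, 0 <= h t) ->
  {ae lebesgue_measure, forall t : R, t \in `[0, 1] ->
     derivable (phi : R -> R^o) t 1 /\ derive1 (phi : R -> R^o) t <= h t} ->
  ((phi 1 - phi 0)%:E <=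
    \int[lebesgue_measure]_(t in `[0%R, 1%R]) (h t)%:E)%E.
Proof.
move=> acphi h0 [N [mN N0 NN]].
set I := (X in (_ <= X)%E).
have [->|Ifin] := eqVneq I +oo%E; first exact: leey.
pose D := `]0, 1[%classic `\` N.
have mD : measurable D by exact: measurableD.
have HD t : D t ->
    derivable (phi : R -> R^o) t 1 /\ derive1 (phi : R -> R^o) t <= h t.
  move=> [/= t01 nNt]; have : t \in `[0, 1].
    by move: t01; rewrite !in_itv/= => /andP[/ltW-> /ltW->].
  by apply: contrapT => Ht; apply: nNt; apply: NN.
pose p t := Num.max 0 (derive1 (phi : R -> R^o) t).
have mp : measurable_fun D p.
  apply: measurable_maxr => //; apply: ac_measurable_derive => //.
  - by move=> t [].
  - by move=> t /HD[].
pose g := p \_ D.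
have g0 t : 0 <= g t.
  by rewrite /g patchE; case: ifP => // _; rewrite le_max lexx.
have mg : measurable_fun setT g.
  by move/(measurable_restrictT p mD): mp.
have gI : (\int[lebesgue_measure]_t (g t)%:E <= I)%E.
  rewrite /I [leRHS]integral_mkcond.
  apply: (@le_integral_ge0 _ _ R (@lebesgue_measure R) setT) => [t _|t _].
    by rewrite lee_fin.
  rewrite patchE /g patchE; case: ifPn => [/set_mem Dt|_].
    rewrite mem_set; last first.
      by case: Dt => + _; rewrite /= !in_itv/= => /andP[/ltW-> /ltW->].
    by rewrite lee_fin ge_max h0; have [] := HD t Dt.
  by case: ifP => // _; rewrite lee_fin.
have ig : lebesgue_measure.-integrable setT (EFin \o g).
  apply/integrableP; split; first exact/measurable_EFinP.
  under eq_integral => t _ do rewrite /= ger0_norm//.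
  by apply: le_lt_trans gI _; rewrite ltey.
have igy (y : R) : lebesgue_measure.-integrable `]-oo, y] (EFin \o g).
  exact: integrableS ig.
have lg : locally_integrable setT g.
  by apply: open_integrable_locally => //; exact: openT.
pose G x := (\int[lebesgue_measure]_(t in `]-oo, x]) g t)%R.
have [N2 [mN2 N20 NN2]] := FTC1Ny igy lg.
have GE x : (G x)%:E = (\int[lebesgue_measure]_(t in `]-oo, x]) (g t)%:E)%E.
  by rewrite /G /Rintegral fineK//; exact: integrable_fin_num.
have ndG a b : a <= b -> G a <= G b.
  move=> ab; rewrite -lee_fin !GE; apply: ge0_subset_integral => //.
  - exact/measurable_EFinP/measurable_funTS.
  - by move=> t _; rewrite lee_fin.
  - by move=> t /=; rewrite !in_itv/= => /le_trans; apply.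
have G1 : ((G 1 - G 0)%:E <= I)%E.
  apply: le_trans gI; apply: (@le_trans _ _ (G 1)%:E).
    rewrite lee_fin gerBl /G; apply: Rintegral_ge0 => // t _; exact: g0.
  rewrite GE; apply: ge0_subset_integral => //; first exact/measurable_EFinP.
  by move=> t _; rewrite lee_fin.
apply: le_trans G1; rewrite lee_fin.
apply: (@ac_increment_le _ _ _ (N `|` N2 `|` [set 0] `|` [set 1])) => //.
- have n1 (x : R) : lebesgue_measure.-negligible [set x].
    by apply/negligibleP; [exact: measurable_set1|exact: lebesgue_measure_set1].
  do 3 (apply: negligibleU => //); exact/negligibleP.
- by move=> a b _ ab _; exact: ndG.
move=> t t0 t1 /not_orP[/not_orP[/not_orP[nN nN2] nt0] nt1] e e0.
have Dt : D t.
  split => //=; rewrite in_itv/= !lt_neqAle t0 t1 !andbT.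
  by apply/andP; split; apply/eqP => // t0'; apply: nt0.
have [dphi dh] := HD t Dt.
have [dG Gt] : derivable (G : R -> R^o) t 1 /\ derive1 (G : R -> R^o) t = g t.
  by apply: contrapT => Ht; apply: nN2; apply: NN2.
have dle : derive1 ((phi : R -> R^o) - (G : R -> R^o)) t <= 0.
  rewrite derive1E deriveB// -!derive1E Gt subr_le0.
  by rewrite /g patchE mem_set// /p le_max lexx orbT.
have [d d0 Hd] := derive_le0_increment (derivableB dphi dG) dle e0.
exists d => // a b _ at_ tb _ bad; have := Hd a b at_ tb bad.
rewrite !fctE; lra.
Qed.

(** * Lebesgue measure on tuples *)

Section TupleMeasure.
Variable R : realType.
Local Notation RM := (measurableTypeR R).
Local Open Scope ereal_scope.

Lemma measurable_cons_preimage N (A : set (N.+1.-tuple RM)) :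
  measurable A -> measurable (@cons_tuple R N @^-1` A).
Proof.
by move=> mA; rewrite -[X in measurable X]setTI; exact: measurable_cons_tuple.
Qed.

Lemma lebesgueNS N (A : set (N.+1.-tuple RM)) :
  lebesgueN R N.+1 A =
  \int[lebesgue_measure]_x lebesgueN R N [set t | A (cons_tuple (x, t))].
Proof.
apply: eq_integral => x _ /=; congr (lebesgueN R N _).
by rewrite xsectionE.
Qed.

Lemma lebesgueNS_swap N (A : set (N.+1.-tuple RM)) : measurable A ->
  lebesgueN R N.+1 A =
  \int[lebesgueN R N]_t lebesgue_measure [set x | A (cons_tuple (x, t))].
Proof.
move=> mA.
transitivity ((@lebesgue_measure R \x^ lebesgueN R N) (@cons_tuple R N @^-1` A)).
  apply: product_measure_unique; last exact: measurable_cons_preimage.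
  by move=> B C mB mC /=; rewrite product_measure2E.
apply: eq_integral => t _ /=; congr (lebesgue_measure _).
by rewrite ysectionE.
Qed.

Lemma measurable_lebesgueN_section N (A : set (N.+1.-tuple RM)) :
  measurable A -> measurable_fun [set: RM]
    (fun x => lebesgueN R N [set t | A (cons_tuple (x, t))]).
Proof.
move=> mA.
rewrite (_ : (fun x => _) = lebesgueN R N \o xsection (@cons_tuple R N @^-1` A)).
  apply: measurable_fun_xsection; exact: measurable_cons_preimage.
by apply/funext => x; rewrite /= xsectionE.
Qed.

Lemma lebesgue_integral_translate (f : RM -> \bar R) (a : R) :
  measurable_fun [set: RM] f -> (forall x, 0 <= f x) ->
  \int[lebesgue_measure]_x f (x + a)%R = \int[lebesgue_measure]_x f x.
Proof.
move=> mf f0.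
have mT : measurable_fun [set: RM] (fun x : RM => (x + a)%R : RM).
  exact: measurable_funD.
have := ge0_integral_pushforward mT lebesgue_measure measurableT mf.
rewrite preimage_setT => /(_ _)/esym/= -> //; apply: eq_measure_integral => A mA _.
apply/esym; apply: (@lebesgue_measure_unique R
  (pushforward lebesgue_measure (fun x : RM => (x + a)%R : RM))) => // _ [[u v]] _ <-.
rewrite /pushforward.
transitivity (lebesgue_measure (`](u - a)%R, (v - a)%R]%classic : set R)).
  rewrite !lebesgue_measure_itv/= !lte_fin ltrD2r; case: ifP => // _.
  by rewrite -!EFinB; congr (_%:E); ring.
congr (lebesgue_measure _); apply/seteqP.
by split => x /=; rewrite !in_itv/= => /andP[h1 h2]; apply/andP; split; lra.
Qed.

End TupleMeasure.

Section Shear.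
Variable R : realType.
Local Notation RM := (measurableTypeR R).

Definition shear N (phi : 'I_N -> N.-tuple RM -> R) (t : N.-tuple RM) :
  N.-tuple RM := [tuple tnth t i + phi i t | i < N].

Lemma measurable_shear N (phi : 'I_N -> N.-tuple RM -> R) :
  (forall i, measurable_fun setT (phi i)) -> measurable_fun setT (shear phi).
Proof.
move=> mphi; apply/measurable_fun_tnthP => i.
rewrite (_ : _ \o _ = (fun t => tnth t i + phi i t)); last first.
  by apply/funext => t /=; rewrite tnth_mktuple.
by apply: measurable_funD => //; exact: measurable_tnth.
Qed.

Lemma measurable_cons_section N (x : R) :
  measurable_fun setT (fun t : N.-tuple RM => @cons_tuple R N (x, t)).
Proof. by apply: measurableT_comp (@measurable_cons_tuple R N) _. Qed.

Lemma tnth_cons_tuple0 N (p : RM * N.-tuple RM) : tnth (cons_tuple p) ord0 = p.1.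
Proof. by rewrite (tnth_nth 0). Qed.

Lemma tnth_cons_tupleS N (p : RM * N.-tuple RM) i :
  tnth (cons_tuple p) (lift ord0 i) = tnth p.2 i.
Proof. by rewrite !(tnth_nth 0). Qed.

(** By induction on the dimension: for a fixed first coordinate a shear is a
    shear in the remaining ones, and on the first coordinate it is a
    translation.  Left translations of the Heisenberg group are shears. *)
Lemma lebesgueN_shear N (phi : 'I_N -> N.-tuple RM -> R) :
  (forall i, measurable_fun setT (phi i)) ->
  (forall (i : 'I_N) t u, (forall j : 'I_N, (j < i)%N -> tnth t j = tnth u j) ->
     phi i t = phi i u) ->
  forall A, measurable A -> lebesgueN R N (shear phi @^-1` A) = lebesgueN R N A.
Proof.
elim: N phi => [|N IH] phi mphi dphi A mA.
  congr (lebesgueN R 0 _); apply/seteqP.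
  split => t; rewrite /preimage/= (_ : shear phi t = t)//;
  by apply: eq_from_tnth => -[].
pose c := phi ord0 (@cons_tuple R N (0, [tuple 0 | i < N])).
have shearE x t : shear phi (cons_tuple (x, t)) =
    cons_tuple (x + c, shear (fun i t => phi (lift ord0 i) (cons_tuple (x, t))) t).
  apply: eq_from_tnth => i; rewrite tnth_mktuple.
  case: (unliftP ord0 i) => [j|] ->.
    by rewrite !tnth_cons_tupleS tnth_mktuple.
  rewrite !tnth_cons_tuple0/=; congr (_ + _).
  by apply: dphi => j; rewrite ltn0.
rewrite lebesgueNS [RHS]lebesgueNS.
have := lebesgue_integral_translate c (measurable_lebesgueN_section mA).
move=> <-; last by move=> x; exact: measure_ge0.
apply: eq_integral => x _.
rewrite -[RHS](IH (fun i t => phi (lift ord0 i) (cons_tuple (x, t)))).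
- congr (lebesgueN R N _); apply/seteqP.
  by split => t; rewrite /preimage/= shearE.
- by move=> i; apply: measurableT_comp (mphi _) _; exact: measurable_cons_section.
- move=> i t u tu; apply: dphi => j.
  case: (unliftP ord0 j) => [k|] -> //.
  by rewrite !tnth_cons_tupleS/= => /tu.
- rewrite -[X in measurable X]setTI; exact: measurable_cons_section.
Qed.

End Shear.

Section Ellipsoid.
Variable R : realType.
Local Notation RM := (measurableTypeR R).

Definition qform N (G : 'M[R]_N) (x : 'rV[R]_N) : R := (x *m G *m x^T) 0 0.

Definition posdef N (G : 'M[R]_N) :=
  G^T = G /\ forall x, x != 0 -> 0 < qform G x.

Section Schur.
Variables (N : nat) (G : 'M[R]_(1 + N)).
Hypothesis pG : posdef G.
Let a := ulsubmx G 0 0.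
Let b := ursubmx G.
(** The form left on the other coordinates after completing the square in the
    first one. *)
Definition schur : 'M[R]_N := drsubmx G - a^-1 *: (b^T *m b).

Lemma posdef_ul_gt0 : 0 < a.
Proof.
have [_ /(_ (row_mx 1%:M 0))] := pG.
rewrite /qform -{1}[G]submxK mul_row_block tr_row_mx mul_row_col.
rewrite !mul0mx !addr0 !trmx0 mulmx0 addr0 trmx1 mulmx1 mul1mx; apply.
apply/eqP => /(congr1 lsubmx) /matrixP /(_ 0 0).
by rewrite row_mxKl !mxE => /eqP; rewrite oner_eq0.
Qed.

Let a0 : a != 0. Proof. exact/lt0r_neq0/posdef_ul_gt0. Qed.

Lemma posdef_dl : dlsubmx G = b^T.
Proof. by have [sG _] := pG; rewrite /b trmx_ursub sG. Qed.

Lemma qform_schur (s : R) (t : 'rV[R]_N) : qform G (row_mx s%:M t) =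
  a * (s + a^-1 * (b *m t^T) 0 0) ^+ 2 + qform schur t.
Proof.
rewrite /qform -{1}[G]submxK mul_row_block tr_row_mx mul_row_col posdef_dl.
rewrite /schur mulmxBr !mulmxBl -scalemxAr -scalemxAl !mulmxDl.
set c := (b *m t^T) 0 0.
have bt : b *m t^T = c%:M by rewrite [LHS]mx11_scalar.
have tb : t *m b^T = c%:M by rewrite -[LHS]trmxK trmx_mul trmxK bt tr_scalar_mx.
rewrite [ulsubmx G]mx11_scalar -/a mulmxA tb -[c%:M *m b *m _]mulmxA bt.
rewrite -[s%:M *m b *m _]mulmxA bt !tr_scalar_mx -!scalar_mxM.
rewrite !mxE !eqxx !mulr1n; field; exact: a0.
Qed.

Lemma posdef_schur : posdef schur.
Proof.
split.
  rewrite /schur linearB linearZ/= trmx_mul trmxK trmx_drsub.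
  by have [-> _] := pG.
move=> t t0; have := qform_schur (- (a^-1 * (b *m t^T) 0 0)) t.
rewrite addNr expr0n mulr0 add0r => <-; apply: (proj2 pG).
apply: contraNneq t0 => /(congr1 rsubmx); rewrite row_mxKr => ->.
by rewrite linear0.
Qed.

Lemma det_schur : \det G = a * \det schur.
Proof.
have -> : G = block_mx 1%:M 0 (a^-1 *: b^T) 1%:M *m block_mx a%:M b 0 schur.
  rewrite mulmx_block !mul1mx !mul0mx !addr0 -[LHS]submxK posdef_dl.
  rewrite [ulsubmx G in LHS]mx11_scalar -/a -/b /schur -scalemxAl; congr block_mx.
    by rewrite mul_mx_scalar scalerA mulVf ?scale1r.
  by rewrite -scalemxAl addrC subrK.
by rewrite det_mulmx det_lblock det_ublock !det1 !mul1r det_scalar1.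
Qed.

End Schur.

Lemma measurable_qform N (G : 'M[R]_N) :
  measurable_fun [set: N.-tuple RM] (fun t => qform G (row_of_tuple t) : RM).
Proof.
rewrite (_ : (fun t => _) = fun t : N.-tuple RM =>
    \sum_j \sum_i (tnth t i * G i j) * tnth t j); last first.
  apply/funext => t; rewrite /qform mxE; apply: eq_bigr => j _.
  by rewrite !mxE mulr_suml; apply: eq_bigr => i _; rewrite mxE.
apply: measurable_sum => j; apply: measurable_sum => i.
apply: measurable_funM; last exact: measurable_tnth.
apply: measurable_funM => //; exact: measurable_tnth.
Qed.

Definition ellipsoid N (G : 'M[R]_N) (r : R) : set (N.-tuple RM) :=
  [set t | qform G (row_of_tuple t) <= r].

Lemma measurable_ellipsoid N (G : 'M[R]_N) r : measurable (ellipsoid G r).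
Proof.
rewrite (_ : ellipsoid G r =
  (fun t => qform G (row_of_tuple t)) @^-1` `]-oo, r]%classic).
  by rewrite -[X in measurable X]setTI; apply: measurable_qform.
by apply/seteqP; split => t; rewrite /ellipsoid/= in_itv.
Qed.

Lemma row_of_cons_tuple N (x : R) (t : N.-tuple RM) :
  row_of_tuple (cons_tuple (x, t)) = row_mx x%:M (row_of_tuple t) :> 'rV_(1 + N).
Proof.
apply/rowP => i; case: (split_ordP i) => j ->; rewrite ?row_mxEl ?row_mxEr !mxE.
  rewrite ord1 eqxx mulr1n (_ : lshift N (ord0 : 'I_1) = (ord0 : 'I_N.+1)).
    by rewrite tnth_cons_tuple0.
  exact/val_inj.
rewrite (_ : rshift 1 j = (lift ord0 j : 'I_N.+1)) ?tnth_cons_tupleS//.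
exact/val_inj.
Qed.

(** A crude volume bound for an ellipsoid, by Fubini: completing the square, the
    slice over a point of the ellipsoid of the Schur complement is an interval
    of length at most [2 sqrt (r / a)], with [a] the upper left entry of [G]. *)
Lemma lebesgue_ellipsoid N (G : 'M[R]_N) (r : R) : posdef G -> 0 <= r ->
  (lebesgueN R N (ellipsoid G r) <=
    ((2 * Num.sqrt r) ^+ N / Num.sqrt (\det G))%:E)%E.
Proof.
elim: N G => [|N IH] G pG r0.
  rewrite det_mx00 sqrtr1 expr0 invr1 mulr1 /= diracE.
  by rewrite lee_fin; case: (_ \in _).
rewrite lebesgueNS_swap; last exact: measurable_ellipsoid.
have a0 := posdef_ul_gt0 pG; set a := ulsubmx _ _ _ in a0.
have pS := posdef_schur pG.
have qS0 (t : N.-tuple RM) : 0 <= qform (schur (N := N) G) (row_of_tuple t).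
  have [->|t0] := eqVneq (row_of_tuple t) 0.
    by rewrite /qform !mul0mx mxE.
  by apply/ltW/(proj2 pS).
pose c := 2 * Num.sqrt (r / a).
have c0 : 0 <= c by rewrite mulr_ge0// sqrtr_ge0.
have sec (t : N.-tuple RM) :
    (lebesgue_measure [set x | ellipsoid G r (cons_tuple (x, t))] <=
      c%:E * (\1_(ellipsoid (schur (N := N) G) r) t)%:E)%E.
  have msec : measurable [set x | ellipsoid G r (cons_tuple (x, t))].
    rewrite -[X in measurable X]setTI.
    have mc : measurable_fun setT (fun x : RM => @cons_tuple R N (x, t)).
      by apply: measurable_cons; [exact: measurable_id|exact: measurable_cst].
    by apply: mc => //; exact: measurable_ellipsoid.
  set e := a^-1 * (ursubmx (G : 'M[R]_(1 + N)) *m (row_of_tuple t)^T) 0 0.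
  have secE x : ellipsoid G r (cons_tuple (x, t)) =
      (a * (x + e) ^+ 2 + qform (schur (N := N) G) (row_of_tuple t) <= r) :> Prop.
    by rewrite /ellipsoid/= row_of_cons_tuple (qform_schur pG).
  rewrite indicE; have [/set_mem tS|ntS] := boolP (t \in ellipsoid _ _).
    rewrite mule1; pose s := Num.sqrt (r / a).
    set I := (`[- e - s, - e + s]%classic : set RM).
    have <- : lebesgue_measure I = c%:E.
      rewrite /I lebesgue_measure_itv/= lte_fin /c -/s; case: ltP => h.
        by rewrite -EFinB; congr (_%:E); ring.
      have s0 : 0 <= s by exact: sqrtr_ge0.
      by congr (_%:E); lra.
    apply: le_measure_sub; [exact: msec|exact: measurable_itv|].
    move=> x; rewrite /I /= secE in_itv/= => xr.
    have /ler_wsqrtr : (x + e) ^+ 2 <= r / a.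
      by rewrite ler_pdivlMr// mulrC; have := qS0 t; lra.
    rewrite sqrtr_sqr -/s ler_norml => /andP[h1 h2].
    by apply/andP; split; lra.
  rewrite mule0 (_ : [set x | _] = set0) ?measure0//.
  apply/seteqP; split => // x /=; rewrite secE => xr; move/negP: ntS; apply.
  rewrite inE /ellipsoid/=; apply: le_trans xr; rewrite lerDr.
  by rewrite mulr_ge0 ?sqr_ge0// ltW.
apply: (@le_trans _ _ (\int[lebesgueN R N]_t
    (c%:E * (\1_(ellipsoid (schur (N := N) G) r) t)%:E))%E).
  by apply: le_integral_ge0 => t _; [exact: measure_ge0|exact: sec].
rewrite ge0_integralZl//; last first.
- by apply/measurable_EFinP; apply: measurable_indic; exact: measurable_ellipsoid.
rewrite integral_indic// ?setIT; last exact: measurable_ellipsoid.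
apply: le_trans (lee_wpmul2l _ (IH _ pS r0)) _; first by rewrite lee_fin.
rewrite -EFinM lee_fin (det_schur pG) -/a /c exprS.
rewrite (sqrtrM _ r0) (sqrtrV (ltW a0)) (sqrtrM _ (ltW a0)) invfM.
by rewrite le_eqVlt; apply/orP; left; apply/eqP; ring.
Qed.

End Ellipsoid.

Lemma measurable_row_mulmx (R : realType) N p (A : 'M[R]_(N, p)) i :
  measurable_fun [set: N.-tuple (measurableTypeR R)]
    (fun t => (row_of_tuple t *m A) 0 i : measurableTypeR R).
Proof.
rewrite (_ : (fun t => _) = fun t : N.-tuple (measurableTypeR R) =>
    \sum_j tnth t j * A j i); last first.
  by apply/funext => t; rewrite mxE; apply: eq_bigr => j _; rewrite mxE.
apply: measurable_sum => j; apply: measurable_funM => //.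
exact: measurable_tnth.
Qed.

Lemma measurable_parallelotope (R : realType) N (A : 'M[R]_N) :
  measurable [set t : N.-tuple (measurableTypeR R) |
    forall i, `|(row_of_tuple t *m A) 0 i| <= 1].
Proof.
rewrite (_ : [set t | _] = \bigcap_(i in [set: 'I_N])
    (fun t => (row_of_tuple t *m A) 0 i) @^-1` `[-1, 1]%classic); last first.
  apply/seteqP; split => t /= tA i.
    by move=> _ /=; rewrite in_itv/= -ler_norml.
  by have := tA i Logic.I; rewrite /= in_itv/= -ler_norml.
apply: fin_bigcap_measurable => // i _.
by rewrite -[X in measurable X]setTI; exact: measurable_row_mulmx.
Qed.

(** The parallelotope lies in the ellipsoid of the form [|x A|^2] of radius
    [sqrt N].  The factor [1 / |det A|] is what matters; going through
    quadratic forms gives it without the change of variables formula. *)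
Lemma lebesgue_parallelotope (R : realType) N (A : 'M[R]_N) :
  A \in unitmx ->
  (lebesgueN R N [set t | forall i, `|(row_of_tuple t *m A) 0 i| <= 1]%R <=
    ((2 * Num.sqrt N%:R) ^+ N / `|\det A|)%:E)%E.
Proof.
move=> uA; pose G := A *m A^T.
have qE x : qform G x = \sum_i (x *m A) 0 i ^+ 2.
  rewrite /qform mulmxA -mulmxA -trmx_mul mxE; apply: eq_bigr => i _.
  by rewrite [X in _ * X]mxE expr2.
have pG : posdef G.
  split=> [|x x0]; first by rewrite /G trmx_mul trmxK.
  rewrite qE lt_neqAle sumr_ge0 ?andbT; last by move=> i _; exact: sqr_ge0.
  apply: contra x0 => /eqP/esym/eqP; rewrite psumr_eq0; last first.
    by move=> i _; exact: sqr_ge0.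
  move=> /allP xA; apply/eqP; rewrite -[x](mulmxK uA).
  suff -> : x *m A = 0 by rewrite mul0mx.
  apply/rowP => i; rewrite [RHS]mxE; apply/eqP; rewrite -sqrf_eq0.
  by apply: xA; rewrite mem_index_enum.
have detG : \det G = \det A ^+ 2 by rewrite det_mulmx det_tr expr2.
rewrite -sqrtr_sqr -detG.
apply: le_trans (lebesgue_ellipsoid pG (ler0n _ _)).
apply: le_measure_sub.
- exact: measurable_parallelotope.
- exact: measurable_ellipsoid.
move=> t tA; rewrite /ellipsoid/= qE -[N in N%:R]card_ord -sum1_card natr_sum.
by apply: ler_sum => i _; rewrite -real_normK ?num_real// expr_le1.
Qed.

(** Cut [F] into pieces according to the first [k] such that [g k] moves a point
    into [P]: the images of the pieces lie in [P], and they are disjoint since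
    [F] meets each orbit at most once. *)
Lemma measure_fundamental_domain_le d (T : measurableType d) (R : realType)
    (mu : {measure set T -> \bar R}) (g g' : nat -> T -> T) (F P : set T) :
  (forall k, measurable_fun setT (g k)) ->
  (forall k, measurable_fun setT (g' k)) ->
  (forall k, cancel (g' k) (g k)) ->
  (forall k A, measurable A -> mu (g' k @^-1` A) = mu A) ->
  measurable F -> measurable P ->
  (forall p, F p -> exists k, P (g k p)) ->
  (forall j k p q, F p -> F q -> g j p = g k q -> p = q) ->
  (mu F <= mu P)%E.
Proof.
move=> mg mg' g'K mug' mF mP Fcov Finj.
pose E k := F `&` g k @^-1` P.
have mgA (h : T -> T) A : measurable_fun setT h -> measurable A ->
    measurable (h @^-1` A).
  by move=> mh mA; rewrite -[X in measurable X]setTI; exact: mh.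
have mE k : measurable (E k) by apply: measurableI => //; exact: mgA.
have mD k : measurable (seqDU E k).
  by apply: measurableD => //; exact: bigsetU_measurable.
have FE : F = \bigcup_k seqDU E k.
  rewrite -seqDU_bigcup_eq; apply/seteqP; split => [p Fp|p [k _ []]//].
  by have [k Pk] := Fcov p Fp; exists k.
have tD := @trivIset_seqDU _ E.
rewrite {1}FE measure_bigcup//.
under eq_eseriesr => k _ do rewrite -(mug' k)//.
rewrite -measure_bigcup//.
- apply: le_measure_sub => //.
    by apply: bigcup_measurable => k _; exact: mgA.
  by move=> y [k _ [[_ +] _]]; rewrite /= g'K.
- by move=> k _; exact: mgA.
- move=> j k _ _ [y [/= yj yk]].
  have jk : g' j y = g' k y.
    by apply: (Finj j k); rewrite ?g'K//; [case: yj => -[]|case: yk => -[]].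
  by apply: (tD j k) => //; exists (g' j y); split => //; rewrite jk.
Qed.

(** * Algebra of the Heisenberg group *)

Section HeisenbergAlgebra.
Variables (R : realType) (n : nat).
Local Notation H := (heis R n).
Implicit Types p q r : H.

Definition hcenter : H := row_mx 0 1%:M.

Lemma hcenterZ (c : R) : row_mx 0 c%:M = c *: hcenter :> H.
Proof. by rewrite /hcenter scale_row_mx scaler0 scale_scalar_mx mulr1. Qed.

Lemma mulmx_hcenter (A : 'M[R]_(n + n + 1)) : 
  hcenter *m A = row (rshift (n + n) ord0) A.
Proof.
rewrite rowE; congr (_ *m _); apply/rowP => i.
rewrite mxE; case: (split_ordP i) => j ->; rewrite ?row_mxEl ?row_mxEr !mxE.
  by rewrite eq_lrshift.
by rewrite ord1 !eqxx.
Qed.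

Lemma sympDr p q r : symp p (q + r) = symp p q + symp p r.
Proof. by have := symp_linear p 1 q r; rewrite scale1r mul1r. Qed.

Lemma symp0r p : symp p 0 = 0.
Proof. by rewrite sympC symp0l oppr0. Qed.

Lemma sympZr (c : R) p q : symp p (c *: q) = c * symp p q.
Proof. by have := symp_linear p c q 0; rewrite symp0r !addr0. Qed.

Lemma sympDl p q r : symp (p + q) r = symp p r + symp q r.
Proof. by rewrite sympC sympDr opprD -!(sympC r). Qed.

Lemma sympZl (c : R) p q : symp (c *: p) q = c * symp p q.
Proof. by rewrite sympC sympZr -mulrN -sympC. Qed.

Lemma sympNr p q : symp p (- q) = - symp p q.
Proof. by rewrite -scaleN1r sympZr mulN1r. Qed.

Lemma symppp p : symp p p = 0.
Proof. by have := sympC p p; lra. Qed.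

Lemma symp_hcenterr p : symp p hcenter = 0.
Proof.
rewrite /symp /hx /hy /hcenter row_mxKl !linear0 big1// => i _.
by rewrite !mxE !mulr0 subr0.
Qed.

Lemma symp_hcenterl p : symp hcenter p = 0.
Proof. by rewrite sympC symp_hcenterr oppr0. Qed.

Lemma symp_suml (I : finType) (a : I -> R) (g : I -> H) q :
  symp (\sum_i a i *: g i) q = \sum_i a i * symp (g i) q.
Proof.
elim/big_rec2: _ => [|i x y _ <-]; first exact: symp0l.
by rewrite sympDl sympZl.
Qed.

Lemma symp_mulmxl k (x : 'rV[R]_k) (G : 'M[R]_(k, n + n + 1)) q :
  symp (x *m G) q = \sum_i x 0 i * symp (row i G) q.
Proof. by rewrite mulmx_sum_row symp_suml. Qed.

Lemma symp_mulmxr k (x : 'rV[R]_k) (G : 'M[R]_(k, n + n + 1)) q :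
  symp q (x *m G) = \sum_i x 0 i * symp q (row i G).
Proof.
rewrite sympC symp_mulmxl -sumrN; apply: eq_bigr => i _.
by rewrite -mulrN -sympC.
Qed.

Lemma hx_row (u v : 'rV[R]_n) w : hx (row_mx (row_mx u v) w) = u.
Proof. by rewrite /hx !row_mxKl. Qed.

Lemma hy_row (u v : 'rV[R]_n) w : hy (row_mx (row_mx u v) w) = v.
Proof. by rewrite /hy row_mxKl row_mxKr. Qed.

Lemma symp_nondegenerate p :
  (forall q, symp p q = 0) -> exists c : R, p = c *: hcenter.
Proof.
move=> p0; exists (hz p).
have ex i : hx p 0 i = 0.
  have := p0 (row_mx (row_mx 0 (delta_mx 0 i)) 0).
  rewrite /symp hx_row hy_row.
  rewrite (bigD1 i)//= big1 ?addr0 => [|j ji].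
    by rewrite [delta_mx _ _ _ _]mxE [X in _ - _ * X]mxE !eqxx mulr1 mulr0 subr0.
  by rewrite [delta_mx _ _ _ _]mxE [X in _ - _ * X]mxE (negPf ji) andbF !mulr0 subr0.
have ey i : hy p 0 i = 0.
  have := p0 (row_mx (row_mx (delta_mx 0 i) 0) 0).
  rewrite /symp hx_row hy_row.
  rewrite (bigD1 i)//= big1 ?addr0 => [|j ji].
    rewrite [delta_mx _ _ _ _]mxE [X in _ * X - _]mxE !eqxx mulr1 mulr0 sub0r.
    by move=> /eqP; rewrite oppr_eq0 => /eqP.
  by rewrite [delta_mx _ _ _ _]mxE [X in _ * X - _]mxE (negPf ji) andbF !mulr0 subr0.
rewrite -hcenterZ; apply: heisP.
- by rewrite [in RHS]/hx row_mxKl linear0; apply/rowP => i; rewrite ex mxE.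
- by rewrite [in RHS]/hy row_mxKl linear0; apply/rowP => i; rewrite ey mxE.
- by rewrite [in RHS]/hz row_mxKr mxE eqxx mulr1n.
Qed.

Lemma symp_neq0 : (1 <= n)%N -> exists p q, symp p q != 0.
Proof.
move=> n1; apply: contrapT => Hn.
have s0 p q : symp p q = 0.
  by apply: contrapT => /eqP pq; apply: Hn; exists p, q.
have [c pc] := symp_nondegenerate (s0 (row_mx (const_mx 1) 0)).
have := congr1 lsubmx pc; rewrite /hcenter scale_row_mx !row_mxKl scaler0.
move=> /rowP/(_ (lshift n (Ordinal n1))); rewrite !mxE => /eqP.
by rewrite oner_eq0.
Qed.

Lemma hmulE p q : hmul p q = p + q + (2^-1 * symp p q) *: hcenter.
Proof.
have := hmul_affine p 0 q 1; rewrite !scale1r addr0 hcenterZ => ->.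
suff -> : hmul p 0 = p by rewrite addrC addrA.
have hE (u : H) : hmul 0 u = u := hmul0p u.
apply: heisP; rewrite ?hxE ?hyE ?hzE ?symp0r ?mulr0 ?addr0.
- by rewrite [hx 0]/hx !linear0 addr0.
- by rewrite [hy 0]/hy !linear0 addr0.
- by rewrite [hz 0]/hz linear0 mxE addr0.
Qed.

Lemma hmul_comm p q : symp p q = 0 -> hmul p q = p + q.
Proof. by move=> pq; rewrite hmulE pq mulr0 scale0r addr0. Qed.

Lemma hmul_center p (c : R) : hmul p (c *: hcenter) = p + c *: hcenter.
Proof. by rewrite hmul_comm// sympZr symp_hcenterr mulr0. Qed.

Variable G0 : subgroup R n.
Local Notation Gamma := (subgroup_set G0).

(** This is the group commutator of [p] and [q]. *)
Lemma subgroup_commutator p q : Gamma p -> Gamma q ->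
  Gamma (symp p q *: hcenter).
Proof.
move=> Gp Gq; have := subgroupM (subgroupM Gp Gq) (subgroupV (subgroupM Gq Gp)).
congr (Gamma _); rewrite /hinv hmul_comm; last first.
  rewrite sympNr !hmulE !sympDl !sympDr !sympZl !sympZr.
  by rewrite !symp_hcenterl !symp_hcenterr !symppp [symp q p]sympC; ring.
rewrite !hmulE [symp q p]sympC [q + p]addrC mulrN scaleNr.
rewrite opprD opprK addrACA subrr add0r -scalerDl; congr (_ *: _); lra.
Qed.

Lemma subgroupX p (k : int) : Gamma p -> Gamma (k%:~R *: p).
Proof.
move=> Gp; have Gn (i : nat) : Gamma (i%:R *: p).
  elim: i => [|i IH]; first by rewrite scale0r; exact: subgroup1.
  rewrite -[i.+1%:R]natr1 scalerDl scale1r.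
  rewrite -hmul_comm; first exact: subgroupM.
  by rewrite sympZl symppp mulr0.
case: k => i; first exact: Gn.
by rewrite NegzE mulrNz scaleNr; exact/subgroupV/Gn.
Qed.

Lemma subgroup_center_mul p (c : R) :
  Gamma p -> Gamma (c *: hcenter) -> Gamma (p + c *: hcenter).
Proof. by move=> Gp Gc; rewrite -hmul_center; exact: subgroupM. Qed.

End HeisenbergAlgebra.

(** * Short elements of a lattice and its center *)

Lemma discrete_subgroup_cyclic (R : realType) (A : set R) (e : R) :
  A 0 -> (forall a b, A a -> A b -> A (a - b)) -> 0 < e ->
  (forall a, A a -> `|a| < e -> a = 0) -> (exists2 a, A a & a != 0) ->
  exists z : R, [/\ 0 < z, A z & forall a, A a -> exists k : int, a = k%:~R * z].
Proof.
move=> A0 AB e0 gap [a Aa a0].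
have AN b : A b -> A (- b) by move=> Ab; rewrite -sub0r; exact: AB.
have AD b c : A b -> A c -> A (b + c) by move=> Ab Ac; rewrite -[c]opprK; exact/AB/AN.
have AX b (k : int) : A b -> A (k%:~R * b).
  move=> Ab; have An (i : nat) : A (i%:R * b).
    elim: i => [|i IH]; first by rewrite mul0r.
    by rewrite -natr1 mulrDl mul1r; exact: AD.
  by case: k => i; [exact: An|rewrite NegzE mulrNz mulNr; exact/AN/An].
pose P := [set b | A b /\ 0 < b].
have Pa : P `|a|.
  split; last by rewrite normr_gt0.
  by case: (ler0P a) => // _; exact: AN.
have infP : has_inf P by split; [by exists `|a| | by exists 0 => b [_ /ltW]].
have [z [Az z0] zP] := inf_adherent e0 infP.
have zmin b : P b -> z <= b.
  move=> Pb; rewrite leNgt; apply/negP => bz.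
  have Pinf : inf P <= b by apply: ge_inf => //; case: infP.
  have [Ab _] := Pb.
  suff : z - b = 0 by lra.
  by apply: gap; [exact: AB|rewrite gtr0_norm; lra].
exists z; split => // b Ab; exists (Num.floor (b / z)).
have /andP[fl fu] := mem_rg1_floor (b / z).
set k := Num.floor _ in fl fu *.
have Ar : A (b - k%:~R * z) by apply: AB => //; exact: AX.
have r0 : 0 <= b - k%:~R * z by rewrite subr_ge0 -ler_pdivlMr.
have rz : b - k%:~R * z < z.
  by move: fu; rewrite ltr_pdivrMr// mulrDl mul1r => fu; lra.
apply: contrapT => /eqP bk; suff : z <= b - k%:~R * z by lra.
by apply: zmin; split => //; rewrite lt_neqAle r0 eq_sym subr_eq0 bk.
Qed.

Section LatticeStructure.
Variables (R : realType) (n : nat).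
Local Notation m := (n + n)%N.
Local Notation H := (heis R n).
Variable G0 : subgroup R n.
Local Notation Gamma := (subgroup_set G0).
Local Notation Z := (@hcenter R n).

Lemma isolated_center_gap : Gamma `<=` isolated Gamma ->
  exists2 e : R, 0 < e & forall c, Gamma (c *: Z) -> `|c| < e -> c = 0.
Proof.
move=> /(_ 0 (subgroup1 G0)) [_ [V V0 VG]].
have /nbhs_ballP[r/= r0 rV] := V0.
have Zp : 0 < `|Z| + 1 by rewrite ltr_wpDl.
exists (r / (`|Z| + 1)); first exact: divr_gt0.
move=> c Gc; rewrite ltr_pdivlMr// => cr.
have : (V `&` Gamma) (c *: Z).
  split => //; apply: rV; rewrite -ball_normE /= sub0r normrN normrZ.
  by apply: le_lt_trans cr; rewrite ler_wpM2l// lerDl.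
rewrite VG /= => /(congr1 (@rsubmx _ _ m 1)).
rewrite linearZ/= row_mxKr linear0 => /matrixP/(_ 0 0).
by rewrite !mxE mulr1.
Qed.

Variable B : 'M[R]_(m + 1).
Hypothesis uB : B \in unitmx.
Hypothesis ZB : Z *m B = Z.

(** The coordinates [s_i]; [Z *m B = Z] says that [B] is the inverse of a frame
    whose last vector is [Z]. *)
Definition hcoord (p : H) : 'rV[R]_m := lsubmx (p *m B).

Lemma hcoord_linear (a : R) p q : hcoord (a *: p + q) = a *: hcoord p + hcoord q.
Proof. by rewrite /hcoord mulmxDl -scalemxAl !linearP. Qed.

Lemma hcoord_center (c : R) : hcoord (c *: Z) = 0.
Proof. by rewrite /hcoord -scalemxAl ZB linearZ/= row_mxKl scaler0. Qed.

Lemma hcoordD p q : hcoord (p + q) = hcoord p + hcoord q.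
Proof. by have := hcoord_linear 1 p q; rewrite !scale1r. Qed.

Lemma hcoordM p q : hcoord (hmul p q) = hcoord p + hcoord q.
Proof. by rewrite hmulE hcoordD hcoord_center addr0 hcoordD. Qed.

Lemma hcoord_mulmx k (x : 'rV[R]_k) (G : 'M[R]_(k, m + 1)) :
  hcoord (x *m G) = x *m lsubmx (G *m B).
Proof. by rewrite /hcoord -mulmxA -[in LHS](hsubmxK (G *m B)) mul_mx_row row_mxKl. Qed.

Variable l : R.
Hypothesis l0 : 0 <= l.
Hypothesis cover : forall p : H, exists2 g, Gamma g &
  forall i, `|hcoord (hmul g p) 0 i| <= l.

Definition short (p : H) := forall i, `|hcoord p 0 i| <= 2 * l + 1.

(** Apply [cover] to the point [w] with [s_i = (l + 1) sg f_i]: some [g + w] has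
    coordinates at most [l], where [f] is at most [l |f|], while [f w] is
    [(l + 1) |f|]; hence [f g < 0]. *)
Lemma short_vector_off (f : 'cV[R]_m) : f != 0 ->
  exists g, [/\ Gamma g, short g & (hcoord g *m f) 0 0 != 0].
Proof.
move=> f0; pose w : 'rV[R]_m := \row_i ((l + 1) * Num.sg (f i 0)).
have [g Gg gw] := cover (row_mx w 0 *m invmx B).
have {}gw i : `|hcoord g 0 i + w 0 i| <= l.
  have := gw i; rewrite hcoordM [X in hcoord _ + X](_ : _ = w) ?mxE//.
  by rewrite /hcoord mulmxKV ?row_mxKl.
have wl i : `|w 0 i| <= l + 1.
  rewrite mxE normrM normr_sg ger0_norm ?addr_ge0//.
  by rewrite ler_piMr ?addr_ge0//; case: (_ == 0).
exists g; split => //.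
  move=> i; rewrite -[hcoord g 0 i](addrK (w 0 i)).
  by apply: le_trans (ler_normB _ _) _; have := gw i; have := wl i; lra.
pose F := \sum_i `|f i 0|.
have Fgt0 : 0 < F.
  rewrite lt_neqAle sumr_ge0// andbT; apply: contra f0 => /eqP/esym/eqP.
  rewrite psumr_eq0// => /allP fi; apply/eqP/colP => i; rewrite mxE.
  by apply/eqP; rewrite -normr_eq0; apply: fi; rewrite mem_index_enum.
have wf : (w *m f) 0 0 = (l + 1) * F.
  rewrite mxE mulr_sumr; apply: eq_bigr => i _.
  by rewrite mxE -mulrA [in RHS]normrEsg.
have gwf : ((hcoord g + w) *m f) 0 0 <= l * F.
  rewrite mxE mulr_sumr; apply: ler_sum => i _.
  apply: le_trans (ler_norm _) _; rewrite normrM ler_wpM2r// mxE; exact: gw.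
rewrite lt_eqF//; move: gwf; rewrite mulmxDl mxE wf => h.
by have : (hcoord g *m f) 0 0 <= - F; lra.
Qed.

(** Each step adds a short element off the kernel of a form that vanishes on the
    elements found so far. *)
Lemma short_independent k : (k <= m)%N -> exists G : 'M[R]_(k, m + 1),
  [/\ forall i, Gamma (row i G), forall i, short (row i G) &
      row_free (lsubmx (G *m B))].
Proof.
elim: k => [_|k IH km].
  exists 0; split; [by case|by case|].
  by rewrite -row_leq_rank.
have [G [GG sG fG]] := IH (ltnW km).
set S := lsubmx _ in fG.
have [f f0 Sf] : exists2 f : 'cV[R]_m, f != 0 & S *m f = 0.
  have : kermx S^T != 0.
    rewrite -mxrank_eq0 mxrank_ker mxrank_tr -lt0n subn_gt0.
    by rewrite (leq_ltn_trans (rank_leq_row S)).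
  rewrite -nz_row_eq0 => f0; exists (nz_row (kermx S^T))^T.
    by rewrite -trmx0 (inj_eq (@trmx_inj _ _ _)).
  apply: trmx_inj; rewrite trmx_mul trmxK trmx0.
  by apply/sub_kermxP; exact: nz_row_sub.
have [g [Gg sg gf]] := short_vector_off f0.
rewrite -addn1; exists (col_mx G g); split.
- by move=> i; case: (split_ordP i) => j ->; rewrite ?rowKu// rowKd row_id.
- by move=> i; case: (split_ordP i) => j ->; rewrite ?rowKu// rowKd row_id.
rewrite mul_col_mx.
have -> : lsubmx (col_mx (G *m B) (g *m B)) = col_mx S (hcoord g).
  rewrite -[G *m B in LHS]hsubmxK -[g *m B in LHS]hsubmxK.
  by rewrite -block_mxEv block_mxEh row_mxKl.
apply: inj_row_free => v; rewrite -[v]hsubmxK mul_row_col => v0.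
have gz : rsubmx v *m hcoord g *m f = 0.
  have := congr1 (mulmxr f) v0; rewrite /= mulmxDl -[lsubmx v *m S *m f]mulmxA.
  rewrite Sf mulmx0 add0r.
  by rewrite mul0mx.
have vr : rsubmx v = 0.
  move: gz; rewrite -mulmxA [hcoord g *m f]mx11_scalar mul_mx_scalar => /eqP.
  by rewrite scaler_eq0 (negPf gf)/= => /eqP.
rewrite vr mul0mx addr0 in v0 *; suff -> : lsubmx v = 0 by rewrite row_mx0.
by apply: (row_free_inj fG); rewrite v0 mul0mx.
Qed.

End LatticeStructure.

Section AdaptedBasis.
Variables (R : realType) (n : nat).
Local Notation m := (n + n)%N.
Local Notation H := (heis R n).
Local Notation Z := (@hcenter R n).

(** The rows of [G] are elements of [G0] that generate a subgroup of finite index,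
    the last of them a generator of the center of [G0]; [N] is the matrix of
    their commutators.  The last row and column of [N] vanish, so the
    nondegeneracy is that of the upper left block. *)
Record adapted_basis (G0 : subgroup R n) (G : 'M[R]_(m + 1)) (z : R)
    (N : 'M[int]_(m + 1)) : Prop := AdaptedBasis {
  ab_unit : G \in unitmx;
  ab_gt0 : 0 < z;
  ab_last : row (rshift m ord0) G = z *: Z;
  ab_mem : forall i, subgroup_set G0 (row i G);
  ab_symp : forall i j, symp (row i G) (row j G) = (N i j)%:~R * z;
  ab_center : forall c : R, subgroup_set G0 (c *: Z) ->
    exists k : int, c = k%:~R * z;
  ab_det : \det (ulsubmx N) != 0 }.

Variable G0 : subgroup R n.
Local Notation Gamma := (subgroup_set G0).
Hypothesis dG : Gamma `<=` isolated Gamma.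
Variable B : 'M[R]_(m + 1).
Hypothesis uB : B \in unitmx.
Hypothesis ZB : Z *m B = Z.
Variable l : R.
Hypothesis l0 : 0 <= l.
Hypothesis cover : forall p : H, exists2 g, Gamma g &
  forall i, `|hcoord B (hmul g p) 0 i| <= l.
Hypothesis n1 : (1 <= n)%N.

Lemma exists_adapted_basis : exists G z N, adapted_basis G0 G z N /\
  forall i j, `|hcoord B (row (lshift 1 i) G) 0 j| <= 2 * l + 1.
Proof.
have [g [Gg sg fg]] := short_independent uB ZB l0 cover (leqnn m).
set S := lsubmx _ in fg.
have uS : S \in unitmx by rewrite -row_free_unit.
have span (p : H) : exists (x : 'rV[R]_m) (c : R), p = x *m g + c *: Z.
  exists (hcoord B p *m invmx S).
  set q := p - (hcoord B p *m invmx S) *m g.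
  have q0 : hcoord B q = 0.
    rewrite /q -scaleN1r addrC hcoord_linear hcoord_mulmx -/S mulmxKV//.
    by rewrite scaleN1r addNr.
  exists ((q *m B) 0 (rshift m ord0)).
  suff -> : (q *m B) 0 (rshift m ord0) *: Z = q by rewrite /q addrC subrK.
  apply: (can_inj (mulmxK uB)); rewrite -scalemxAl ZB.
  rewrite -[RHS]hsubmxK -/(hcoord B q) q0 scale_row_mx scaler0; congr row_mx.
  by rewrite [RHS]mx11_scalar scale_scalar_mx mulr1 [rsubmx _ 0 0]mxE.
have symp_g0 p : (forall i, symp p (row i g) = 0) -> forall q, symp p q = 0.
  move=> pg q; have [x [c ->]] := span q.
  rewrite sympDr sympZr symp_hcenterr mulr0 addr0 symp_mulmxr big1// => i _.
  by rewrite pg mulr0.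
have [e e0 gap] := isolated_center_gap dG.
have [z [z0 Gz zP]] : exists z : R, [/\ 0 < z, Gamma (z *: Z) &
    forall c, Gamma (c *: Z) -> exists k : int, c = k%:~R * z].
  apply: (@discrete_subgroup_cyclic R [set c | Gamma (c *: Z)] e) => //.
  - by rewrite /= scale0r; exact: subgroup1.
  - move=> a b /= Ga Gb; rewrite scalerBl -scaleNr.
    by apply: subgroup_center_mul => //; rewrite scaleNr; exact: (subgroupV Gb).
  apply: contrapT => Hn.
  have s0 i j : symp (row i g) (row j g) = 0.
    apply: contrapT => /eqP ij; apply: Hn.
    by exists (symp (row i g) (row j g)) => //; exact: subgroup_commutator.
  have [p [q]] := symp_neq0 R n1; case/eqP.
  apply: (symp_g0 p) => i; rewrite sympC symp_g0 ?oppr0// => j; exact: s0.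
pose G : 'M[R]_(m + 1) := col_mx g (z *: Z).
have rGl i : row (lshift 1 i) G = row i g by rewrite rowKu.
have rGr : row (rshift m ord0) G = z *: Z by rewrite rowKd row_id.
have GG i : Gamma (row i G).
  by case: (split_ordP i) => j ->; rewrite ?rGl// ord1 rGr.
have Gs i j : Gamma (symp (row i G) (row j G) *: Z).
  exact: subgroup_commutator.
pose N : 'M[int]_(m + 1) := \matrix_(i, j) sval (cid (zP _ (Gs i j))).
have HN i j : symp (row i G) (row j G) = (N i j)%:~R * z.
  by rewrite mxE; exact: svalP (cid (zP _ (Gs i j))).
exists G, z, N; split; last by move=> i j; rewrite rGl; exact: sg.
split => //.
- have : \det (G *m B) != 0.
    rewrite /G mul_col_mx -scalemxAl ZB -[g *m B]hsubmxK.
    rewrite [z *: Z]scale_row_mx scaler0 -block_mxEv det_ublock mulf_neq0//.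
      by move: uS; rewrite unitmxE unitfE.
    by rewrite scale_scalar_mx mulr1 det_scalar1 gt_eqF.
  by rewrite det_mulmx mulf_eq0 negb_or unitmxE unitfE => /andP[].
- apply: contraTneq isT => dN0.
  pose Nr : 'M[R]_m := map_mx intr (ulsubmx N).
  have : ~~ row_free Nr.
    by rewrite row_free_unit unitmxE det_map_mx dN0 rmorph0 unitr0.
  move=> /negP; case; apply: inj_row_free => x xN.
  have sxg j : symp (x *m g) (row j g) = 0.
    rewrite symp_mulmxl.
    have := congr1 (fun y : 'rV[R]_m => y 0 j) xN; rewrite !mxE => xj.
    transitivity ((\sum_i x 0 i * Nr i j) * z); last by rewrite xj mul0r.
    rewrite mulr_suml; apply: eq_bigr => i _.
    by rewrite -!rGl HN !mxE mulrA.
  have [c xc] := symp_nondegenerate (symp_g0 _ sxg).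
  have : hcoord B (x *m g) = 0 by rewrite xc hcoord_center.
  rewrite hcoord_mulmx -/S => xS; by rewrite -[x](mulmxK uS) xS mul0mx.
Qed.

End AdaptedBasis.

(** * Encoding a lattice by finite data *)

Section Coordinates.
Variables (R : realType) (n : nat).
Local Notation m := (n + n)%N.
Local Notation H := (heis R n).
Local Notation Z := (@hcenter R n).
Local Notation last := (rshift m (@ord0 0)).

(** In the coordinates of an adapted basis the symplectic form is [z * nform N],
    so that the group law [cmul] depends on [N] only. *)
Definition nform (N : 'M[int]_(m + 1)) (x y : H) : R :=
  \sum_i \sum_j x 0 i * y 0 j * (N i j)%:~R.

Definition cmul N (x y : H) : H := x + y + (2^-1 * nform N x y) *: Z.

(** The points of mesh [1 / q] in a box containing the fundamental box
    [0, 2[^2n x [0, 1[ of the group of even points. *)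
Definition grid_point (q : nat) (f : {ffun 'I_(m + 1) -> 'I_(q.*2).+1}) : H :=
  \row_i ((f i : nat)%:R / q%:R).

Definition lattice_code (G0 : subgroup R n) (G : 'M[R]_(m + 1)) (q : nat) :
  {set {ffun 'I_(m + 1) -> 'I_(q.*2).+1}} :=
  [set f | `[< subgroup_set G0 (grid_point f *m G) >]].

(** These points form a subgroup for every commutator matrix [N], as half the form
    [nform N] is an integer on vectors with even coordinates; with odd
    coordinates half-integers would appear. *)
Definition even_point (k : 'rV[int]_m) (c : int) : H :=
  row_mx (2 *: map_mx intr k) c%:~R%:M.

Section OneLattice.
Variables (G0 : subgroup R n) (G : 'M[R]_(m + 1)) (z : R) (N : 'M[int]_(m + 1)).
Hypothesis ab : adapted_basis G0 G z N.
Local Notation Gamma := (subgroup_set G0).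
Let z0 : z != 0. Proof. by rewrite gt_eqF//; exact: (ab_gt0 ab). Qed.

Lemma symp_nform x y : symp (x *m G) (y *m G) = nform N x y * z.
Proof.
rewrite symp_mulmxl mulr_suml; apply: eq_bigr => i _.
rewrite symp_mulmxr mulr_sumr mulr_suml; apply: eq_bigr => j _.
by rewrite (ab_symp ab); ring.
Qed.

Lemma hcenter_mulmx : Z *m G = z *: Z.
Proof. by rewrite mulmx_hcenter (ab_last ab). Qed.

Lemma cmul_mulmx x y : cmul N x y *m G = hmul (x *m G) (y *m G).
Proof.
rewrite hmulE symp_nform /cmul !mulmxDl -scalemxAl hcenter_mulmx.
by rewrite scalerA mulrA.
Qed.

Let Gt (x : H) := Gamma (x *m G).

Lemma coord_cmul x y : Gt x -> Gt y -> Gt (cmul N x y).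
Proof. by move=> Gx Gy; rewrite /Gt cmul_mulmx; exact: subgroupM. Qed.

Lemma coordX x (k : int) : Gt x -> Gt (k%:~R *: x).
Proof. by move=> Gx; rewrite /Gt -scalemxAl; exact: subgroupX. Qed.

Lemma coordN x : Gt x -> Gt (- x).
Proof. by move=> /(@coordX _ (- 1)); rewrite mulrN1z scaleN1r. Qed.

Lemma coord_delta i : Gt (delta_mx 0 i).
Proof. by rewrite /Gt -rowE; exact: (ab_mem ab). Qed.

Lemma coord_center (c : int) : Gt (c%:~R *: Z).
Proof.
rewrite /Gt -scalemxAl hcenter_mulmx -(ab_last ab).
exact/subgroupX/(ab_mem ab).
Qed.

Lemma coord_center_int (c : R) : Gt (c *: Z) -> c \is a Num.int.
Proof.
rewrite /Gt -scalemxAl hcenter_mulmx scalerA => /(ab_center ab)[k].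
by move/(mulIf z0) => ->; exact: intr_int.
Qed.

Lemma nform_hmul x y : nform N x y = symp (x *m G) (y *m G) / z.
Proof. by rewrite symp_nform mulfK. Qed.

Lemma nform_centerl (c : R) x y : nform N (x + c *: Z) y = nform N x y.
Proof.
rewrite !nform_hmul mulmxDl -scalemxAl hcenter_mulmx sympDl !sympZl.
by rewrite symp_hcenterl !mulr0 addr0.
Qed.

Lemma nform_centerr (c : R) x y : nform N x (y + c *: Z) = nform N x y.
Proof.
rewrite !nform_hmul mulmxDl -scalemxAl hcenter_mulmx sympDr !sympZr.
by rewrite symp_hcenterr !mulr0 addr0.
Qed.

Lemma even_pointE k c :
  even_point k c = row_mx (2 *: map_mx intr k) 0 + c%:~R *: Z.
Proof.
rewrite /hcenter scale_row_mx scaler0 add_row_mx addr0 add0r scale_scalar_mx.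
by rewrite mulr1.
Qed.

Lemma even_pointN k c : - even_point k c = even_point (- k) (- c).
Proof.
by rewrite /even_point opp_row_mx map_mxN scalerN mulrNz raddfN.
Qed.

(** Additivity in [k] up to an integral central correction reduces to multiples of
    the basis vectors. *)
Lemma coord_even_exists (k : 'rV[int]_m) : exists c, Gt (even_point k c).
Proof.
rewrite [k]row_sum_delta.
apply: (big_ind (fun k => exists c, Gt (even_point k c))).
- exists 0; rewrite /even_point map_mx0 scaler0 raddf0 row_mx0 /Gt mul0mx.
  exact: subgroup1.
- move=> a b [c Gc] [d Gd].
  pose e : int := \sum_(i < m) \sum_(j < m) a 0 i * b 0 j * N (lshift 1 i) (lshift 1 j).
  exists (c + d + 2 * e); have := coord_cmul Gc Gd; congr Gt.
  rewrite /cmul (even_pointE a) (even_pointE b) nform_centerl nform_centerr.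
  rewrite even_pointE (_ : nform _ _ _ = (4 * e)%:~R).
    rewrite addrACA -!addrA -!scalerDl !addrA; congr (_ + _ *: _).
      by rewrite add_row_mx addr0 map_mxD scalerDr.
    by rewrite !rmorphD !rmorphM/=; field.
  rewrite /nform big_split_ord/= [X in _ + X]big1 ?addr0 => [|i _]; last first.
    by rewrite big1// => j _; rewrite row_mxEr mxE !mul0r.
  rewrite /e rmorphM rmorph_sum mulr_sumr; apply: eq_bigr => i _.
  rewrite rmorph_sum mulr_sumr big_split_ord/= [X in _ + X]big1 ?addr0 => [|j _]; last first.
    by rewrite row_mxEr [X in _ * X * _]mxE mulr0 mul0r.
  apply: eq_bigr => j _; rewrite !row_mxEl !mxE !rmorphM/=; ring.
move=> i _; exists 0.
rewrite (_ : even_point _ _ = (2 * k 0 i)%:~R *: delta_mx 0 (lshift 1 i)).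
  exact/coordX/coord_delta.
rewrite even_pointE scale0r addr0; apply/rowP => j; rewrite [RHS]mxE.
case: (split_ordP j) => j' ->; rewrite ?row_mxEl ?row_mxEr !mxE.
  by rewrite (inj_eq (@lshift_inj _ _)) !rmorphM/= mulrA; case: (_ == _).
by rewrite eq_rlshift andbF mulr0.
Qed.

Lemma coord_even (k : 'rV[int]_m) c : Gt (even_point k c).
Proof.
have [d Gd] := coord_even_exists k.
have -> : even_point k c = cmul N (even_point k d) ((c - d)%:~R *: Z).
  rewrite /cmul -[X in nform N _ X]add0r nform_centerr !even_pointE.
  rewrite (_ : nform _ _ 0 = 0); last first.
    by rewrite nform_hmul mul0mx symp0r mul0r.
  by rewrite mulr0 scale0r addr0 -addrA -scalerDl -rmorphD [d + _]addrC subrK.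
exact/coord_cmul/coord_center.
Qed.

(** Subtract even integers from the first coordinates, and then an integer from
    the last one, which the first step has changed. *)
Lemma coord_reduce x : exists k c (y : H),
  [/\ x = cmul N (even_point k c) y, forall i, 0 <= y 0 i < 2 &
      Gt x -> Gt y].
Proof.
pose k : 'rV[int]_m := \row_i - Num.floor (x 0 (lshift 1 i) / 2).
pose y := cmul N (even_point k 0) x.
pose c := - Num.floor (y 0 last).
pose w := even_point k c.
have wE : cmul N w x = y + c%:~R *: Z.
  rewrite /w /y !even_pointE /cmul !nform_centerl scale0r addr0.
  by rewrite -!addrA; congr (_ + _); rewrite addrC -!addrA.
have cK : cmul N (- w) (cmul N w x) = x.
  have : cmul N (- w) (cmul N w x) *m G = x *m G.
    by rewrite !cmul_mulmx hmulA mulNmx hmulVp hmul0p.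
  by apply: (can_inj (mulmxK (ab_unit ab))).
exists (- k), (- c), (cmul N w x); split.
- by rewrite -even_pointN.
- move=> i; rewrite wE mxE [X in _ + X]mxE; case: (split_ordP i) => j ->.
    rewrite row_mxEl [X in _ * X]mxE mulr0 addr0 /y /cmul even_pointE scale0r addr0.
    rewrite !mxE (unsplitK (inl _)) !mxE mulr0 addr0.
    have /andP[] := mem_rg1_floor (x 0 (lshift 1 j) / 2); rewrite rmorphN/=.
    by set f := _%:~R; lra.
  rewrite ord1 row_mxEr [X in _ * X]mxE eqxx mulr1 /c.
  have /andP[] := mem_rg1_floor (y 0 last); rewrite rmorphN/=.
  by set f := _%:~R; lra.
- move=> Gx; apply: coord_cmul => //; exact: coord_even.
Qed.

(** Commutators of [x] with the basis are integers, which says that the first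
    coordinates times the block of [N] are integers: Cramer's rule divides by
    the determinant [d].  For the last coordinate, [2 d x] has even first
    coordinates, and dividing it by an even point leaves a central element. *)
Lemma coord_grid x (q : nat) : Gt x ->
  (2 * `|\det (ulsubmx N)| %| q)%N -> forall i, q%:R * x 0 i \is a Num.int.
Proof.
move=> Gx dq; pose d := \det (ulsubmx N); pose Nr : 'M[R]_m := map_mx intr (ulsubmx N).
have xN j : (lsubmx x *m Nr) 0 j \is a Num.int.
  have : Gt (nform N x (delta_mx 0 (lshift 1 j)) *: Z).
    rewrite /Gt -scalemxAl hcenter_mulmx scalerA -symp_nform.
    exact/subgroup_commutator/coord_delta.
  move=> /coord_center_int; rewrite -[x in nform _ x]hsubmxK.
  rewrite (_ : row_mx _ _ = row_mx (lsubmx x) 0 + (x 0 last) *: Z); last first.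
    rewrite /hcenter scale_row_mx scaler0 add_row_mx addr0 add0r scale_scalar_mx.
    by rewrite mulr1 [rsubmx x in LHS]mx11_scalar mxE.
  rewrite nform_centerl; congr (_ \is a Num.int).
  rewrite /nform big_split_ord/= [X in _ + X]big1 ?addr0 => [|i _]; last first.
    by rewrite big1// => j' _; rewrite row_mxEr mxE !mul0r.
  rewrite mxE; apply: eq_bigr => i _; rewrite row_mxEl (bigD1 (lshift 1 j))//=.
  rewrite big1 ?addr0 => [|j' j'j]; last first.
    by rewrite [delta_mx _ _ _ _]mxE (negPf j'j) andbF mulr0 mul0r.
  by rewrite !mxE !eqxx mulr1.
have xd i : d%:~R * x 0 (lshift 1 i) \is a Num.int.
  have -> : d%:~R * x 0 (lshift 1 i) = (lsubmx x *m Nr *m \adj Nr) 0 i.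
    by rewrite -mulmxA mul_mx_adj mul_mx_scalar det_map_mx !mxE.
  rewrite mxE; apply: rpred_sum => j _; apply: rpredM; first exact: xN.
  rewrite -map_mx_adj mxE; exact: intr_int.
have [e ->] := dvdnP dq; rewrite !natrM.
have absd : (`|d|%N%:R : R) = d%:~R \/ (`|d|%N%:R : R) = - d%:~R.
  by rewrite natr_absz intr_norm; case: (ler0P (d%:~R : R)) => _; [right|left].
have xd' i : `|d|%N%:R * x 0 (lshift 1 i) \is a Num.int.
  by case: absd => ->; rewrite ?mulNr ?rpredN; exact: xd.
move=> i; rewrite -mulrA; apply: rpredM; first exact: natr_int.
case: (split_ordP i) => j ->.
  by rewrite -mulrA; apply: rpredM; [exact: natr_int|exact: xd'].
pose k : 'rV[int]_m := \row_i Num.floor (`|d|%N%:R * x 0 (lshift 1 i)).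
pose u : H := (2 * `|d|%N%:R) *: x.
have Gu : Gt u.
  by have := @coordX x (2 * `|d|%N)%N Gx; rewrite -pmulrn natrM.
have uE : u = even_point k 0 + (2 * `|d|%N%:R * x 0 last) *: Z.
  apply/rowP => a; rewrite even_pointE scale0r addr0 [RHS]mxE [X in _ + X]mxE.
  rewrite [LHS]mxE.
  case: (split_ordP a) => b ->; rewrite ?row_mxEl ?row_mxEr.
    by rewrite !mxE mulr0 addr0 floorK -?mulrA.
  by rewrite ord1 !mxE eqxx mulr1 add0r.
have : Gt ((2 * `|d|%N%:R * x 0 last) *: Z).
  have := coord_cmul (coordN (coord_even k 0)) Gu; congr Gt.
  rewrite /cmul uE nform_centerr addrA addNr add0r.
  by rewrite nform_hmul mulNmx sympNl symppp oppr0 mul0r mulr0 scale0r addr0.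
by move/coord_center_int; rewrite [j]ord1.
Qed.

(** The right hand side depends only on [N] and on the code. *)
Lemma coord_codeP (q : nat) x : (0 < q)%N ->
  (2 * `|\det (ulsubmx N)| %| q)%N ->
  Gt x <-> exists k c f, f \in lattice_code G0 G q /\
    x = cmul N (even_point k c) (@grid_point q f).
Proof.
move=> q0 dq; split=> [Gx|[k [c [f [+ ->]]]]]; last first.
  by rewrite inE => /asboolP; apply: coord_cmul; exact: coord_even.
have [k [c [y [xE y02 Gy]]]] := coord_reduce x.
have {}Gy := Gy Gx.
have q0' : (0 : R) < q%:R by rewrite ltr0n.
pose f : {ffun 'I_(m + 1) -> 'I_(q.*2).+1} :=
  [ffun i => inord `|Num.floor (q%:R * y 0 i)%R|%N].
have fy : grid_point f = y.
  apply/rowP => i; rewrite mxE ffunE.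
  have /andP[y0 y2] := y02 i.
  have qy0 : 0 <= q%:R * y 0 i by rewrite mulr_ge0.
  have /floorK fl := coord_grid Gy dq i.
  have aE : (`|Num.floor (q%:R * y 0 i)%R|%N%:R : R) = q%:R * y 0 i.
    by rewrite natr_absz intr_norm fl ger0_norm.
  rewrite inordK; last first.
    by rewrite ltnS -(ler_nat R) aE -muln2 natrM ler_wpM2l// ltW.
  by rewrite aE mulrC mulKf// gt_eqF.
exists k, c, f; split; last by rewrite fy.
by rewrite inE fy; exact/asboolP.
Qed.

End OneLattice.
(** The automorphism maps one adapted basis to the other. *)
Lemma same_code_isomorphic (G0 G0' : subgroup R n) G G' z z' N q :
  adapted_basis G0 G z N -> adapted_basis G0' G' z' N -> (0 < q)%N ->
  (2 * `|\det (ulsubmx N)| %| q)%N ->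
  lattice_code G0 G q = lattice_code G0' G' q ->
  exists2 P : 'M[R]_(m + 1), P \in unitmx &
    (forall p r, hmul p r *m P = hmul (p *m P) (r *m P)) /\
    (forall p, subgroup_set G0 p <-> subgroup_set G0' (p *m P)).
Proof.
move=> ab ab' q0 dq ecode; exists (invmx G *m G').
  by rewrite unitmx_mul unitmx_inv (ab_unit ab) (ab_unit ab').
have uG := ab_unit ab.
split=> [p r|p].
  rewrite -{1}[p](mulmxKV uG) -{1}[r](mulmxKV uG) -(cmul_mulmx ab).
  by rewrite mulmxA mulmxK// (cmul_mulmx ab') !mulmxA.
rewrite -{1}[p](mulmxKV uG) mulmxA.
rewrite (coord_codeP ab _ q0 dq) (coord_codeP ab' _ q0 dq).
by rewrite ecode.
Qed.

End Coordinates.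

(** * Linear automorphisms and diffeomorphisms *)

Section LinearMaps.
Variable R : realType.

Lemma mx_entry_norm_le k (x : 'rV[R]_k) i : `|x 0 i| <= `|x|.
Proof.
rewrite [leRHS]mx_normrE.
exact: (le_bigmax 0 (fun ij : 'I_1 * 'I_k => `|x ij.1 ij.2|) (0, i)).
Qed.

Lemma mulmx_norm_le k p (P : 'M[R]_(k, p)) (x : 'rV[R]_k) :
  `|x *m P| <= (\sum_i \sum_j `|P i j|) * `|x|.
Proof.
have s0 i : 0 <= \sum_j `|P i j| by apply: sumr_ge0.
rewrite [leLHS]mx_normrE; apply: bigmax_le => [|[i j] _ /=].
  by rewrite mulr_ge0// sumr_ge0.
rewrite mxE mulr_suml; apply: le_trans (ler_norm_sum _ _ _) _.
apply: ler_sum => a _; rewrite normrM mulrC ord1.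
apply: ler_pM => //; last exact: mx_entry_norm_le.
by rewrite (bigD1 j)//= lerDl sumr_ge0.
Qed.

Lemma continuous_mulmxr k p (P : 'M[R]_(k, p)) :
  continuous (fun x : 'rV[R]_k => x *m P).
Proof.
set C := \sum_i \sum_j `|P i j|.
have C0 : 0 <= C by apply: sumr_ge0 => i _; exact: sumr_ge0.
move=> x; apply/(@cvgrPdist_lt _ _ _ (nbhs x)) => e e0.
apply/nbhs_ballP; exists (e / (C + 1)) => /= [|y]; first by rewrite divr_gt0// ltr_wpDl.
rewrite -ball_normE /= ltr_pdivlMr ?ltr_wpDl// => xy; rewrite -mulmxBl.
apply: le_lt_trans (mulmx_norm_le _ _) _; apply: le_lt_trans xy.
by rewrite mulrC ler_wpM2l// lerDl.
Qed.

Variables (V : normedModType R) (k p : nat) (P : 'M[R]_(k, p)).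

Lemma is_derive_mulmxr (f : V -> 'rV[R]_k) x v : derivable f x v ->
  derivable (fun y => f y *m P) x v /\
  'D_v (fun y => f y *m P) x = 'D_v f x *m P.
Proof.
move=> df; have cvP : (fun h => h^-1 *: (((fun y => f y *m P) \o shift x) (h *: v)
    - f x *m P)) @ 0^' --> 'D_v f x *m P.
  rewrite (_ : (fun h => _) = (fun u : 'rV[R]_k => u *m P) \o
      (fun h => h^-1 *: ((f \o shift x) (h *: v) - f x))).
    exact: (cvg_comp _ _ df (@continuous_mulmxr k p P _)).
  by apply/funext => h /=; rewrite -scalemxAl mulmxBl.
by split; [apply/cvg_ex; eexists; exact: cvP|exact: cvg_lim cvP].
Qed.

End LinearMaps.

Section SmoothLinear.
Variables (R : realType) (k : nat).
Local Notation H := 'rV[R]_k.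
Variable P : 'M[R]_k.

(** Directional derivatives commute with a linear map, by linearity of limits. *)
Lemma smooth_on_mulmxr (U : set H) (F : H -> H) : open U ->
  smooth_on U F -> smooth_on U (fun x => F x *m P).
Proof.
move=> oU sF.
have iE vs x : U x -> iter_derive vs (fun x => F x *m P) x = iter_derive vs F x *m P.
  elim: vs x => [//|v vs IH] x Ux /=.
  have [_ /(_ v) dF] := sF vs x Ux.
  have [_ <-] := is_derive_mulmxr P dF; apply: near_eq_derive.
  by near=> y; apply: IH; near: y; exact: open_nbhs_nbhs.
move=> vs x Ux; have [cF dF] := sF vs x Ux.
have nE : \near x, iter_derive vs F x *m P = iter_derive vs (fun x => F x *m P) x.
  by near=> y; apply/esym/iE; near: y; exact: open_nbhs_nbhs.
split=> [|v].
  rewrite /prop_for /continuous_at iE//; apply: cvg_trans (near_eq_cvg nE) _.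
  exact: (cvg_comp _ _ cF (@continuous_mulmxr R k k P _)).
apply: near_eq_derivable nE _.
by have [] := is_derive_mulmxr P (dF v).
Unshelve. all: by end_near. Qed.

Lemma smooth_on_comp_mulmxr (U : set H) (F : H -> H) :
  smooth_on U F -> smooth_on [set x | U (x *m P)] (fun x => F (x *m P)).
Proof.
move=> sF.
have quotE (G : H -> H) x v : (fun h : R => h^-1 *:
      (((fun x => G (x *m P)) \o shift x) (h *: v) - G (x *m P))) =
    (fun h => h^-1 *: ((G \o shift (x *m P)) (h *: (v *m P)) - G (x *m P))).
  by apply/funext => h /=; rewrite mulmxDl -scalemxAl.
have derE (G : H -> H) x v : 'D_v (fun x => G (x *m P)) x = 'D_(v *m P) G (x *m P).
  exact: (congr1 (fun q : R -> H => lim (q @ 0^')) (quotE G x v)).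
have iE vs : iter_derive vs (fun x => F (x *m P)) =
    fun x => iter_derive [seq v *m P | v <- vs] F (x *m P).
  elim: vs => [//|v vs IH] /=; rewrite IH; apply/funext => x.
  exact: derE.
move=> vs x Ux; have [cF dF] := sF [seq v *m P | v <- vs] (x *m P) Ux.
rewrite iE; split=> [|v].
  exact: (cvg_comp _ _ (@continuous_mulmxr R k k P x) cF).
exact: (eq_ind _ (fun q : R -> H => cvg (q @ 0^')) (dF (v *m P)) _
  (esym (quotE (iter_derive [seq v *m P | v <- vs] F) x v))).
Qed.

End SmoothLinear.

Section QuotientMaps.
Local Open Scope quotient_scope.
Variables (R : realType) (n : nat).
Local Notation H := (heis R n).

Definition quot_map (G0 G1 : subgroup R n) (P : 'M[R]_(n + n + 1))
  (x : heis_quot G0) : heis_quot G1 := \pi_(heis_quot G1) (repr x *m P).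

Lemma quot_eqP (G0 : subgroup R n) (p q : H) :
  \pi_(heis_quot G0) p = \pi_(heis_quot G0) q <->
  exists2 g, subgroup_set G0 g & q = hmul g p.
Proof.
split=> [/eqmodP/asboolP//|Hq]; apply/eqmodP; exact/asboolP.
Qed.

Lemma quot_map_pi (G0 G1 : subgroup R n) (P : 'M[R]_(n + n + 1)) :
  (forall p q, hmul p q *m P = hmul (p *m P) (q *m P)) ->
  (forall p, subgroup_set G0 p -> subgroup_set G1 (p *m P)) ->
  forall p, quot_map G1 P (\pi_(heis_quot G0) p) = \pi_(heis_quot G1) (p *m P).
Proof.
move=> PM PG p; rewrite /quot_map; apply/quot_eqP.
have /quot_eqP[g Gg pE] : \pi_(heis_quot G0) (repr (\pi_(heis_quot G0) p)) =
    \pi_(heis_quot G0) p by rewrite reprK.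
by exists (g *m P); [exact: PG|rewrite {1}pE PM].
Qed.

(** Compose the given diffeomorphisms with the bijection of quotients induced by
    the automorphism [P]. *)
Lemma diffeomorphic_sub (G0 G1 G2 : subgroup R n) (P : 'M[R]_(n + n + 1)) :
  P \in unitmx ->
  (forall p q, hmul p q *m P = hmul (p *m P) (q *m P)) ->
  (forall p, subgroup_set G0 p <-> subgroup_set G1 (p *m P)) ->
  diffeomorphic G0 G2 -> diffeomorphic G1 G2.
Proof.
move=> uP PM PG [f [g [fK gK sf sg]]].
pose Q := invmx P.
have QM p q : hmul p q *m Q = hmul (p *m Q) (q *m Q).
  by apply: (can_inj (mulmxK uP)); rewrite PM !mulmxKV.
have QG p : subgroup_set G1 p -> subgroup_set G0 (p *m Q).
  by move=> G1p; apply/PG; rewrite mulmxKV.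
pose a := quot_map G1 P : heis_quot G0 -> heis_quot G1.
pose b := quot_map G0 Q : heis_quot G1 -> heis_quot G0.
have aE p : a (\pi_(heis_quot G0) p) = \pi_(heis_quot G1) (p *m P).
  by apply: quot_map_pi => // r /PG.
have bE p : b (\pi_(heis_quot G1) p) = \pi_(heis_quot G0) (p *m Q).
  exact: quot_map_pi.
have abK : cancel a b.
  by move=> x; rewrite -[x]reprK aE bE mulmxK.
have baK : cancel b a.
  by move=> x; rewrite -[x]reprK bE aE mulmxKV.
exists (f \o b), (a \o g); split.
- by move=> x /=; rewrite fK baK.
- by move=> x /=; rewrite abK gK.
- move=> p; have [U [F [[oU Up] sF FE]]] := sf (p *m Q).
  exists [set x | U (x *m Q)], (fun x => F (x *m Q)); split.
  + split => //; apply: (@open_comp _ _ (mulmxr Q)) => // x _.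
    exact: continuous_mulmxr.
  + exact: (smooth_on_comp_mulmxr sF).
  + by move=> q /= Uq; rewrite bE FE.
- move=> p; have [U [F [[oU Up] sF FE]]] := sg p.
  exists U, (fun x => F x *m P); split.
  + by split.
  + exact: (smooth_on_mulmxr P oU sF).
  + by move=> q Uq /=; rewrite (FE _ Uq) aE.
Qed.

Lemma diffeo_class_eq (G0 G1 : lattice R n) (P : 'M[R]_(n + n + 1)) :
  P \in unitmx ->
  (forall p q, hmul p q *m P = hmul (p *m P) (q *m P)) ->
  (forall p, subgroup_set G0 p <-> subgroup_set G1 (p *m P)) ->
  diffeo_class G0 = diffeo_class G1.
Proof.
move=> uP PM PG; apply/seteqP; split => G2; rewrite /diffeo_class/=.
  exact: diffeomorphic_sub uP PM PG.
apply: (@diffeomorphic_sub _ _ _ (invmx P)).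
- by rewrite unitmx_inv.
- by move=> p q; apply: (can_inj (mulmxK uP)); rewrite PM !mulmxKV.
- by move=> p; rewrite PG mulmxKV.
Qed.

End QuotientMaps.

(** * Horizontal paths *)

Section HorizontalPaths.
Variables (R : realType) (n : nat).
Local Notation H := (heis R n).

Lemma ac_mulmxr (c : R -> H) (f : 'cV[R]_(n + n + 1)) : abs_continuous 0 1 c ->
  abs_continuous 0 1 (fun t => (c t *m f) 0 0 : R^o).
Proof.
move=> acc e e0; set C := \sum_i \sum_j `|f i j|.
have C0 : 0 <= C by apply: sumr_ge0 => i _; exact: sumr_ge0.
have C1 : 0 < C + 1 by rewrite ltr_wpDl.
have [d d0 Hd] := acc (e / (C + 1)) (divr_gt0 e0 C1).
exists d => // s s1 s2 s3.
have := Hd s s1 s2 s3; rewrite ltr_pdivlMr//; apply: le_lt_trans.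
rewrite mulrC mulr_sumr; apply: ler_sum => I _.
have -> : (c I.2 *m f) 0 0 - (c I.1 *m f) 0 0 = ((c I.2 - c I.1) *m f) 0 0.
  by rewrite mulmxBl [RHS]mxE [X in _ = _ + X]mxE.
apply: le_trans (mx_entry_norm_le _ _) _; apply: le_trans (mulmx_norm_le _ _) _.
by rewrite ler_wpM2r// lerDl.
Qed.

Lemma is_derive_coord (c : R -> H) (f : 'cV[R]_(n + n + 1)) (t : R) :
  derivable c t 1 ->
  derivable (fun t => (c t *m f) 0 0 : R^o) t 1 /\
  derive1 (fun t => (c t *m f) 0 0 : R^o) t = (derive1 c t *m f) 0 0.
Proof.
move=> dc; have [df dE] := is_derive_mulmxr f dc.
have dij := (derivable_mxP _ _ _).1 df.
split; first exact: dij.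
by rewrite !derive1E -dE derive_mx// mxE.
Qed.

(** A linear form [f] that kills the center takes the same value on the velocity
    and on the derivative of [c], since these differ by a central vector. *)
Lemma horizontal_coord_le (M : sr_metric R n) (c : R -> H)
    (f : 'cV[R]_(n + n + 1)) :
  @hcenter R n *m f = 0 ->
  (forall v, v \in sr_space M -> (v *m f) 0 0 ^+ 2 <= sr_ip M v v) ->
  horizontal M c ->
  (`|(c 1 *m f) 0 0 - (c 0 *m f) 0 0|%:E <= sr_length M c)%E.
Proof.
move=> Zf fM [acc dc].
suff main (g : 'cV[R]_(n + n + 1)) : @hcenter R n *m g = 0 ->
    (forall v, v \in sr_space M -> (v *m g) 0 0 ^+ 2 <= sr_ip M v v) ->
    (((c 1 *m g) 0 0 - (c 0 *m g) 0 0)%:E <= sr_length M c)%E.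
  have negE (p : H) : (p *m - f) 0 0 = - (p *m f) 0 0 by rewrite mulmxN [LHS]mxE.
  case: (ler0P ((c 1 *m f) 0 0 - (c 0 *m f) 0 0)) => _; last exact: main.
  have := main (- f); rewrite !negE -opprB opprK addrC opprB; apply.
  - by rewrite mulmxN Zf oppr0.
  - by move=> v vM; rewrite negE sqrrN; exact: fM.
move=> Zg gM; have velE t : (velocity c t *m g) 0 0 = (derive1 c t *m g) 0 0.
  rewrite /velocity maurer_cartanE hcenterZ mulmxBl -scalemxAl Zg scaler0.
  by rewrite subr0.
apply: (@ac_increment_le_integral R (fun t => (c t *m g) 0 0)).
- exact: ac_mulmxr.
- by move=> t; exact: sqrtr_ge0.
apply: filterS dc; first exact: (ae_filter_ringOfSetsType lebesgue_measure).
move=> t dt t01; have [dct vM] := dt t01.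
have [dg gE] := is_derive_coord g dct; split => //.
rewrite gE -velE; apply: le_trans (ler_norm _) _.
by rewrite -sqrtr_sqr ler_wsqrtr// gM.
Qed.

End HorizontalPaths.

(** * Orthonormal frames and the Popp density *)

Section AdaptedFrames.
Variables (R : realType) (n : nat).
Local Notation m := (n + n)%N.
Local Notation H := (heis R n).
Local Notation Z := (@hcenter R n).
Local Notation last := (rshift m (@ord0 0)).

Definition frame_mx (U : (m + 1).-tuple H) : 'M[R]_(m + 1) :=
  \matrix_(i < m + 1) tnth U i.

Lemma frame_mx_unit (U : (m + 1).-tuple H) :
  basis_of {: H}%VS U -> frame_mx U \in unitmx.
Proof.
move=> bU; rewrite -row_free_unit; apply: inj_row_free => v.
rewrite mulmx_sum_row => v0; apply/rowP => i; rewrite mxE.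
have /freeP fU := basis_free bU; apply: (fU (fun i => v 0 i)).
by rewrite -[RHS]v0; apply: eq_bigr => j _; rewrite rowK (tnth_nth 0).
Qed.

Lemma coord_frame_mx (U : (m + 1).-tuple H) (x : H) i :
  basis_of {: H}%VS U -> coord U i x = (x *m invmx (frame_mx U)) 0 i.
Proof.
move=> bU; rewrite [in RHS](coord_basis bU (memvf x)).
rewrite (_ : \sum_i _ = (\row_i coord U i x) *m frame_mx U).
  by rewrite mulmxK ?mxE// frame_mx_unit.
rewrite mulmx_sum_row; apply: eq_bigr => j _.
by rewrite mxE rowK (tnth_nth 0).
Qed.

(** Left translations are unipotent: their differential fixes the central vector
    and changes the other basis vectors by multiples of it. *)
Lemma maurer_cartan_det (p : H) (A : 'M[R]_(m + 1)) :
  \det (\matrix_(i, j) (maurer_cartan p (delta_mx 0 j) *m A) 0 i) = \det A.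
Proof.
pose k : 'cV[R]_m := \col_i (- (2^-1 * symp p (delta_mx 0 (lshift 1 i)))).
rewrite -[LHS]det_tr.
have -> : (\matrix_(i, j) (maurer_cartan p (delta_mx 0 j) *m A) 0 i)^T =
    block_mx 1%:M k 0 1%:M *m A.
  apply/row_matrixP => j; rewrite row_mul; apply/rowP => i.
  rewrite mxE mxE mxE; congr ((_ *m A) 0 i).
  have Zlast : delta_mx 0 last = Z.
    by rewrite -[RHS]mulmx1 mulmx_hcenter row1.
  rewrite maurer_cartanE hcenterZ; case: (split_ordP j) => a ->.
    rewrite block_mxEv rowKu delta_mx_lshift -hcenterZ opp_row_mx add_row_mx.
    rewrite oppr0 addr0 add0r row_row_mx row1; congr row_mx.
    by rewrite [RHS]mx11_scalar mxE mxE delta_mx_lshift raddfN.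
  rewrite ord1 Zlast symp_hcenterr mulr0 scale0r subr0.
  by rewrite block_mxEv rowKd row_id.
by rewrite det_mulmx det_ublock !det1 !mul1r.
Qed.

Section Frame.
Variables (M : sr_metric R n) (U : (m + 1).-tuple H).
Hypothesis gM : bracket_generating M.
Hypothesis cM : corank M = 1%N.
Hypothesis aU : adapted_frame M U.
Let bU : basis_of {: H}%VS U. Proof. by case: aU. Qed.
Let K := invmx (frame_mx U).

Lemma frame_expand (x : H) :
  x = \sum_(i < m) (x *m K) 0 (lshift 1 i) *: tnth U (lshift 1 i)
      + (x *m K) 0 last *: tnth U last.
Proof.
rewrite -[LHS](mulmxKV (frame_mx_unit bU)) mulmx_sum_row big_split_ord/= big_ord1.
by rewrite rowK; congr (_ + _); apply: eq_bigr => i _; rewrite rowK.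
Qed.

Lemma sr_space_proper : sr_space M != {: H}%VS.
Proof. by apply: contra_eqN cM => /eqP; rewrite /corank => ->; rewrite subnn. Qed.

Lemma sr_space_last v : v \in sr_space M -> (v *m K) 0 last = 0.
Proof.
move=> vM; apply: contrapT => /eqP b0.
have [_ UM _] := aU.
suff : ({: H} <= sr_space M)%VS.
  by move=> full; move/negP: sr_space_proper; apply; rewrite eqEsubv subvf full.
rewrite -(span_basis bU); apply/span_subvP => u /tnthP[i ->].
case: (split_ordP i) => j ->; first exact: UM.
rewrite ord1 -[tnth U _](scalerK b0); apply: memvZ.
set w := \sum_(i < m) (v *m K) 0 (lshift 1 i) *: tnth U (lshift 1 i).
rewrite -[_ *: tnth _ _](addKr w) -frame_expand; apply: memvD => //; rewrite memvN.
by apply: memv_suml => k _; apply: memvZ; exact: UM.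
Qed.

(** Otherwise [Z] would lie in the distribution, which would then be closed under
    brackets and could not generate. *)
Lemma center_last : (Z *m K) 0 last != 0.
Proof.
apply/eqP => a0; have [_ UM _] := aU.
have ZM : Z \in sr_space M.
  rewrite [Z]frame_expand a0 scale0r addr0.
  by apply: memv_suml => k _; apply: memvZ; exact: UM.
move/eqP: sr_space_proper; apply; apply: gM => u; elim=> // x y _ _ _.
by rewrite lie_bracketE hcenterZ memvZ.
Qed.

Lemma sr_ip_suml (I : Type) (r : seq I) (x : I -> R) (u : I -> H) w :
  (forall i, u i \in sr_space M) -> w \in sr_space M ->
  sr_ip M (\sum_(i <- r) x i *: u i) w = \sum_(i <- r) x i * sr_ip M (u i) w.
Proof.
move=> uM wM; elim: r => [|i r IH].
  rewrite !big_nil; have := sr_ip_linear (mem0v (sr_space M)) (mem0v _) wM 1.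
  by rewrite scaler0 addr0; lra.
rewrite !big_cons sr_ip_linear ?IH//.
by apply: memv_suml => k _; apply: memvZ.
Qed.

Lemma sr_ip_square v : v \in sr_space M ->
  sr_ip M v v = \sum_(i < m) (v *m K) 0 (lshift 1 i) ^+ 2.
Proof.
move=> vM; have [_ UM UO] := aU.
pose x i := (v *m K) 0 (lshift 1 i).
have vE : v = \sum_i x i *: tnth U (lshift 1 i).
  by have := frame_expand v; rewrite sr_space_last// scale0r addr0.
have ipx i : sr_ip M v (tnth U (lshift 1 i)) = x i.
  rewrite {1}vE sr_ip_suml// (bigD1 i)//= UO eqxx mulr1 big1 ?addr0// => j ji.
  by rewrite UO (negPf ji) mulr0.
rewrite {1}vE sr_ip_suml//; apply: eq_bigr => i _.
by rewrite sr_ipC// ipx expr2.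
Qed.

(** The matrix of the frame [u_1, ..., u_2n, Z] in the given frame. *)
Let T : 'M[R]_(m + 1) :=
  block_mx 1%:M 0 (lsubmx (Z *m K)) ((Z *m K) 0 last)%:M.

Definition central_frame := T *m frame_mx U.

Let detT : \det T = (Z *m K) 0 last.
Proof. by rewrite /T det_lblock det1 mul1r det_scalar1. Qed.

Lemma central_frame_unit : central_frame \in unitmx.
Proof.
rewrite unitmx_mul frame_mx_unit// andbT unitmxE unitfE detT.
exact: center_last.
Qed.

Lemma central_frame_last : row last central_frame = Z.
Proof.
rewrite /central_frame row_mul /T block_mxEv rowKd row_id.
rewrite (_ : row_mx _ _ = Z *m K) ?mulmxKV ?frame_mx_unit//.
rewrite -[RHS]hsubmxK; congr row_mx.
by rewrite [RHS]mx11_scalar [rsubmx _ 0 0]mxE.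
Qed.

Lemma central_frame_row i : row (lshift 1 i) central_frame = tnth U (lshift 1 i).
Proof.
rewrite /central_frame row_mul /T block_mxEv rowKu row_row_mx row1 row0.
by rewrite -delta_mx_lshift -rowE rowK.
Qed.

Lemma central_frame_center : Z *m invmx central_frame = Z.
Proof.
by rewrite -{1}central_frame_last -row_mul mulmxV ?central_frame_unit//
  -mulmx_hcenter mulmx1.
Qed.

Lemma central_frame_coord v j : v \in sr_space M ->
  (v *m invmx central_frame) 0 (lshift 1 j) ^+ 2 <= sr_ip M v v.
Proof.
move=> vM.
have -> : v *m invmx central_frame = v *m K.
  have uF := central_frame_unit.
  apply: (can_inj (mulmxK uF)); rewrite mulmxKV// /central_frame mulmxA.
  rewrite -[v *m K]hsubmxK /T mul_row_block.
  have -> : rsubmx (v *m K) = 0.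
    by rewrite [LHS]mx11_scalar [rsubmx _ 0 0]mxE sr_space_last// raddf0.
  rewrite !mul0mx mulmx0 !addr0 mulmx1.
  rewrite (_ : row_mx _ _ = v *m K) ?mulmxKV ?frame_mx_unit//.
  rewrite -[RHS]hsubmxK; congr row_mx.
  by rewrite [RHS]mx11_scalar [rsubmx _ 0 0]mxE sr_space_last// raddf0.
rewrite sr_ip_square// (bigD1 j)//= lerDl sumr_ge0// => i _; exact: sqr_ge0.
Qed.

Definition symp_frame_norm : R := Num.sqrt (\sum_(i < m) \sum_(j < m)
  symp (tnth U (lshift 1 i)) (tnth U (lshift 1 j)) ^+ 2).

(** The structure constants are [symp u_i u_j] times the last coordinate of [Z],
    and the density is constant by [maurer_cartan_det]. *)
Lemma popp_densityE p :
  popp_density U p = (`|(Z *m K) 0 last| * symp_frame_norm)^-1 * \det K.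
Proof.
rewrite /popp_density; congr (_^-1 * _).
  have aE i j : structure_const U i j ^+ 2 = ((Z *m K) 0 last) ^+ 2 *
      symp (tnth U (lshift 1 i)) (tnth U (lshift 1 j)) ^+ 2.
    rewrite /structure_const coord_frame_mx// lie_bracketE hcenterZ.
    by rewrite -scalemxAl mxE -exprMn mulrC.
  under eq_bigr do under eq_bigr do rewrite aE.
  under eq_bigr do rewrite -mulr_sumr.
  by rewrite -mulr_sumr sqrtrM ?sqr_ge0// sqrtr_sqr.
rewrite -[RHS](maurer_cartan_det p); congr (\det _); apply/matrixP => i j.
by rewrite [LHS]mxE [RHS]mxE coord_frame_mx.
Qed.

Lemma popp_density_norm p :
  `|popp_density U p| = `|\det (invmx central_frame)| / symp_frame_norm.
Proof.
rewrite popp_densityE normrM normfV normrM normr_id.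
rewrite [`|symp_frame_norm|]ger0_norm ?sqrtr_ge0//.
rewrite [\det K]det_inv [in RHS]det_inv det_mulmx detT.
by rewrite [in RHS]invfM normrM !normfV invfM; ring.
Qed.

End Frame.
End AdaptedFrames.

(** * Volume of a fundamental domain *)

Section FundamentalDomains.
Variables (R : realType) (n : nat).
Local Notation RM := (measurableTypeR R).
Local Notation m := (n + n)%N.
Local Notation H := (heis R n).
Local Notation Z := (@hcenter R n).
Local Open Scope quotient_scope.

Definition left_translation (g : H) (t : (m + 1).-tuple RM) : (m + 1).-tuple RM :=
  [tuple hmul g (row_of_tuple t) 0 i | i < m + 1].

Lemma row_left_translation g t :
  row_of_tuple (left_translation g t) = hmul g (row_of_tuple t).
Proof. by apply/rowP => i; rewrite mxE tnth_mktuple. Qed.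

Lemma row_of_tuple_inj N : injective (@row_of_tuple R N).
Proof.
move=> t u tu; apply: eq_from_tnth => i.
by have := congr1 (fun r : 'rV[R]_N => r 0 i) tu; rewrite !mxE.
Qed.

(** The central component of the product, expanded in the coordinates of the tuple
    so that the dependence on preceding coordinates is visible. *)
Let translation_shift (g : H) (i : 'I_(m + 1)) (t : (m + 1).-tuple RM) : R :=
  g 0 i + 2^-1 * (\sum_j tnth t j * symp g (delta_mx 0 j)) * Z 0 i.

Let symp_row g (t : (m + 1).-tuple RM) :
  symp g (row_of_tuple t) = \sum_j tnth t j * symp g (delta_mx 0 j).
Proof.
rewrite -[row_of_tuple t]mulmx1 symp_mulmxr; apply: eq_bigr => j _.
by rewrite mxE row1.
Qed.

Lemma left_translation_shear g : left_translation g = shear (translation_shift g).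
Proof.
apply/funext => t; apply: eq_from_tnth => i; rewrite !tnth_mktuple.
rewrite hmulE /translation_shift -symp_row !mxE; ring.
Qed.

Let measurable_translation_shift g i : measurable_fun setT (translation_shift g i).
Proof.
apply: measurable_funD => //; apply: measurable_funM => //.
apply: measurable_funM => //; apply: measurable_sum => j.
by apply: measurable_funM => //; exact: measurable_tnth.
Qed.

Lemma measurable_left_translation g : measurable_fun setT (left_translation g).
Proof. by rewrite left_translation_shear; exact: measurable_shear. Qed.

Lemma left_translation_invariant g (A : set ((m + 1).-tuple RM)) : measurable A ->
  lebesgueN R (m + 1) (left_translation g @^-1` A) = lebesgueN R (m + 1) A.
Proof.
rewrite left_translation_shear => mA; apply: lebesgueN_shear => // i t u tu.
rewrite /translation_shift; case: (split_ordP i) tu => j -> tu.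
  by rewrite /hcenter row_mxEl mxE !mulr0.
congr (_ + _ * _ * _); apply: eq_bigr => k _.
case: (split_ordP k) => a ->; first by rewrite tu//= ltn_addr.
suff -> : delta_mx 0 (rshift m a) = Z by rewrite symp_hcenterr !mulr0.
by rewrite ord1 -[RHS]mulmx1 mulmx_hcenter row1.
Qed.

Variable G0 : subgroup R n.
Local Notation Gamma := (subgroup_set G0).

Lemma lebesgue_fundamental_domain_le (g : nat -> H) (F P : set H) :
  (forall k, Gamma (g k)) -> (forall p, Gamma p -> exists k, g k = p) ->
  fundamental_domain G0 F -> measurable (@row_of_tuple R (m + 1) @^-1` P) ->
  (forall p, exists2 a, Gamma a & P (hmul a p)) ->
  (lebesgueN R (m + 1) (@row_of_tuple R (m + 1) @^-1` F) <=
   lebesgueN R (m + 1) (@row_of_tuple R (m + 1) @^-1` P))%E.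
Proof.
move=> Gg gG [mF uF] mP cov.
apply: (@measure_fundamental_domain_le _ _ _ _ (fun k => left_translation (g k))
  (fun k => left_translation (hinv (g k)))) => //.
- by move=> k; exact: measurable_left_translation.
- by move=> k; exact: measurable_left_translation.
- move=> k t; apply: row_of_tuple_inj; rewrite !row_left_translation hmulA.
  by rewrite -{1}[g k]opprK hmulVp hmul0p.
- by move=> k A mA; exact: left_translation_invariant.
- move=> t _; have [a /gG[k <-] Pa] := cov (row_of_tuple t).
  by exists k; rewrite /preimage/= row_left_translation.
move=> j k t u Ft Fu tu; apply: row_of_tuple_inj.
have [w [_ wu]] := uF (row_of_tuple u).
rewrite -(wu (row_of_tuple u)) //; apply/esym/wu; split => //.
apply/quot_eqP; exists (hmul (hinv (g k)) (g j)).
  by apply: subgroupM => //; exact: subgroupV.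
rewrite -hmulA; have /(congr1 (@row_of_tuple R _)) := tu.
by rewrite !row_left_translation => ->; rewrite hmulA hmulVp hmul0p.
Qed.

End FundamentalDomains.

Section LatticeCountable.
Variables (R : realType) (n : nat).
Local Notation m := (n + n)%N.

(** By [coord_codeP] an element is given by integers and a point of a finite
    grid. *)
Lemma adapted_basis_countable (G0 : subgroup R n) G z N :
  adapted_basis G0 G z N -> exists g : nat -> heis R n,
    (forall k, subgroup_set G0 (g k)) /\
    (forall p, subgroup_set G0 p -> exists k, g k = p).
Proof.
move=> ab; pose q := (2 * `|\det (ulsubmx N)|)%N.
have q0 : (0 < q)%N by rewrite muln_gt0 absz_gt0 (ab_det ab).
pose W := ('rV[int]_m * int * {ffun 'I_(m + 1) -> 'I_(q.*2).+1})%type.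
pose h (w : W) := cmul N (even_point R w.1.1 w.1.2) (grid_point R w.2) *m G.
pose g k := if (unpickle k : option W) is Some w then
  (if `[< subgroup_set G0 (h w) >] then h w else 0) else 0.
exists g; split => [k|p Gp].
  rewrite /g; case: unpickle => [w|]; last exact: subgroup1.
  by case: asboolP => // _; exact: subgroup1.
have uG := ab_unit ab.
have : subgroup_set G0 (p *m invmx G *m G) by rewrite mulmxKV.
move=> /(coord_codeP ab _ q0 (dvdnn _))[k [c [f [_ pE]]]].
exists (pickle (k, c, f)); rewrite /g pickleK/=.
have -> : h (k, c, f) = p by rewrite /h/= -pE mulmxKV.
by rewrite asboolT.
Qed.

End LatticeCountable.

(** * The bound on the commutator matrix *)

Section Bound.
Variables (R : realType) (n : nat).
Local Notation m := (n + n)%N.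
Local Notation H := (heis R n).
Local Notation Z := (@hcenter R n).
Local Notation last := (rshift m (@ord0 0)).
Local Open Scope quotient_scope.

Lemma mulmx_col k p (x : 'rV[R]_k) (A : 'M[R]_(k, p)) j :
  x *m col j A = col j (x *m A).
Proof. by rewrite !colE mulmxA. Qed.

(** A path of length less than [D + 1] joins the orbits of the identity and of
    [p]; translate its starting point back to the identity. *)
Lemma diameter_cover (G0 : subgroup R n) (M : sr_metric R n) (B : 'M[R]_(m + 1))
    (D : R) :
  Z *m B = Z ->
  (forall v j, v \in sr_space M ->
     (v *m B) 0 (lshift 1 j) ^+ 2 <= sr_ip M v v) ->
  (sr_diam M G0 <= D%:E)%E ->
  forall p, exists2 g, subgroup_set G0 g &
    forall i, `|hcoord B (hmul g p) 0 i| <= D + 1.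
Proof.
move=> ZB BM dD p.
pose x0 : heis_quot G0 := \pi_(heis_quot G0) (0 : H).
pose x1 : heis_quot G0 := \pi_(heis_quot G0) p.
have : (sr_dist M x0 x1 < (D + 1)%:E)%E.
  apply: (@le_lt_trans _ _ D%:E); last by rewrite lte_fin ltrDl.
  by apply: le_trans dD; apply: ereal_sup_ubound; exists (x0, x1).
move=> /ereal_inf_lt[_ [c [hc /esym/quot_eqP[g0 Gg0 c0]
  /esym/quot_eqP[g1 Gg1 c1]] <-] cD].
exists (hmul (hinv g0) g1); first exact/subgroupM/Gg1/subgroupV.
move=> i; rewrite -lee_fin; apply: le_trans (ltW cD).
have colE (x : H) : (x *m col (lshift 1 i) B) 0 0 = hcoord B x 0 i.
  by rewrite mulmx_col mxE [RHS]mxE.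
have Zf : Z *m col (lshift 1 i) B = 0.
  by rewrite mulmx_col ZB; apply/colP => j; rewrite mxE row_mxEl !mxE.
have fM v : v \in sr_space M -> (v *m col (lshift 1 i) B) 0 0 ^+ 2 <= sr_ip M v v.
  by move=> vM; rewrite mulmx_col mxE; exact: BM.
apply: le_trans (horizontal_coord_le Zf fM hc).
rewrite !colE -hmulA -c1 (hcoordM ZB) c0 (hcoordM ZB) lee_fin.
have hcoord0 : hcoord B 0 = 0 by rewrite /hcoord mul0mx linear0.
have -> : hcoord B (hinv g0) = - hcoord B g0 by rewrite /hcoord mulNmx linearN.
by rewrite hcoord0 addr0 [_ + hcoord B (c 1)]addrC [in leLHS]mxE [X in _ + X]mxE.
Qed.

(** The factors come from two short elements, the [(2n)^2] entries of [symp] in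
    the frame, the volume of the box, and the lower bound [V / 2] for the Popp
    integral on some fundamental domain. *)
Definition code_bound (D V : R) : R :=
  (2 * (D + 1) + 1) ^+ 2 * m%:R ^+ 2 *
  (2 * Num.sqrt (m + 1)%:R) ^+ (m + 1) * (D + 1) ^+ m * (2 / V).

(** The fundamental domain is compared with the box [|s_i| <= l, |z'| <= z], with
    [z'] the last coordinate: the covering hypothesis makes the [s_i] small,
    and central elements of the lattice then make [z'] small. *)
Lemma fundamental_domain_volume_le (G0 : subgroup R n) (B G : 'M[R]_(m + 1)) z N
    (l : R) (F : set H) :
  adapted_basis G0 G z N -> B \in unitmx -> Z *m B = Z -> 0 < l ->
  (forall p, exists2 g, subgroup_set G0 g &
    forall i, `|hcoord B (hmul g p) 0 i| <= l) ->
  fundamental_domain G0 F ->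
  (`|\det B|%:E * lebesgueN R (m + 1) (@row_of_tuple R (m + 1) @^-1` F) <=
    ((2 * Num.sqrt (m + 1)%:R) ^+ (m + 1) * l ^+ m * z)%:E)%E.
Proof.
move=> ab uB ZB l0 cov fF; have z0 := ab_gt0 ab.
have [g [gG Gg]] := adapted_basis_countable ab.
pose d : 'rV[R]_(m + 1) := row_mx (const_mx l^-1) (const_mx z^-1).
pose A := B *m diag_mx d.
have AE (p : H) i : (p *m A) 0 i = (p *m B) 0 i * d 0 i.
  by rewrite /A mulmxA mul_mx_diag mxE.
have detA : \det A = \det B * (l ^- m * z^-1).
  rewrite /A det_mulmx det_diag big_split_ord/= big_ord1; congr (_ * (_ * _)).
    rewrite -exprVn -[in RHS](card_ord m) -prodr_const; apply: eq_bigr => i _.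
    by rewrite row_mxEl mxE.
  by rewrite row_mxEr mxE.
have uA : A \in unitmx.
  rewrite unitmxE unitfE detA mulf_neq0//.
    by move: uB; rewrite unitmxE unitfE.
  by rewrite gt_eqF// divr_gt0 ?invr_gt0 ?exprn_gt0.
pose P : set H := [set p | forall i, `|(p *m A) 0 i| <= 1].
have covP p : exists2 a, subgroup_set G0 a & P (hmul a p).
  have [a Ga al] := cov p.
  have [w wE] : exists w, w = hmul a p *m B by exists (hmul a p *m B).
  have wl j : `|w 0 (lshift 1 j)| <= l by have := al j; rewrite /hcoord -wE mxE.
  pose y := w 0 last; pose k := - Num.floor (y / z).
  have Gk : subgroup_set G0 ((k%:~R * z) *: Z).
    rewrite -scalerA -(ab_last ab); exact/subgroupX/(ab_mem ab).
  exists (hmul ((k%:~R * z) *: Z) a); first exact: subgroupM.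
  move=> i; rewrite -hmulA AE hmul_comm; last by rewrite sympZl symp_hcenterl mulr0.
  rewrite mulmxDl -scalemxAl ZB -wE mxE [X in X + _]mxE.
  case: (split_ordP i) => j ->; rewrite /hcenter ?row_mxEl ?row_mxEr !mxE.
    by rewrite mulr0 add0r normrM normfV (gtr0_norm l0) ler_pdivrMr// mul1r.
  rewrite ord1 eqxx mulr1 -/y.
  have /andP[fl fu] := mem_rg1_floor (y / z).
  rewrite /k rmorphN/= mulrDl mulfK ?gt_eqF// ler_norml.
  by apply/andP; split; lra.
have mP : measurable (@row_of_tuple R (m + 1) @^-1` P).
  exact: measurable_parallelotope.
have FP := lebesgue_fundamental_domain_le gG Gg fF mP covP.
apply: le_trans (lee_wpmul2l _ FP) _.
  by rewrite lee_fin.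
apply: le_trans (lee_wpmul2l _ (lebesgue_parallelotope uA)) _.
  by rewrite lee_fin.
rewrite -EFinM lee_fin detA normrM invfM.
set K := (2 * _) ^+ _; rewrite le_eqVlt; apply/orP; left; apply/eqP.
have dB : `|\det B| != 0 by rewrite normr_eq0; move: uB; rewrite unitmxE unitfE.
have -> : `|l ^- m / z|^-1 = l ^+ m * z.
  by rewrite gtr0_norm ?divr_gt0 ?invr_gt0 ?exprn_gt0// invfM !invrK.
by move: (l ^+ m) (`|\det B|) dB => u v v0; field.
Qed.

End Bound.

(** * Finiteness *)

Section Finiteness.
Variables (R : realType) (n : nat).
Local Notation m := (n + n)%N.
Local Notation H := (heis R n).
Local Notation Z := (@hcenter R n).
Local Notation last := (rshift m (@ord0 0)).

Lemma symp_le_frame_norm (M : sr_metric R n) (U : (m + 1).-tuple H) (L : R)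
    (p q : H) (B := invmx (central_frame U)) :
  bracket_generating M -> corank M = 1%N -> adapted_frame M U -> 0 <= L ->
  (forall i, `|hcoord B p 0 i| <= L) -> (forall i, `|hcoord B q 0 i| <= L) ->
  `|symp p q| <= L ^+ 2 * m%:R ^+ 2 * symp_frame_norm U.
Proof.
move=> gM cM aU L0 pL qL.
have uC := central_frame_unit gM cM aU.
have lastC := central_frame_last aU.
have rowC i := central_frame_row U i.
have UU i j : `|symp (tnth U (lshift 1 i)) (tnth U (lshift 1 j))| <= symp_frame_norm U.
  rewrite -sqrtr_sqr ler_wsqrtr// (bigD1 i)//= (bigD1 j)//= -addrA lerDl.
  apply: addr_ge0; first by apply: sumr_ge0 => k _; exact: sqr_ge0.
  by apply: sumr_ge0 => k _; apply: sumr_ge0 => k' _; exact: sqr_ge0.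
rewrite -[p](mulmxKV uC) -[q](mulmxKV uC) -/B.
have hE (x : H) j : (x *m B) 0 (lshift 1 j) = hcoord B x 0 j by rewrite [RHS]mxE.
rewrite symp_mulmxl big_split_ord/= big_ord1 lastC symp_hcenterl mulr0 addr0.
have -> : L ^+ 2 * m%:R ^+ 2 * symp_frame_norm U =
    \sum_(i < m) L * (\sum_(j < m) L * symp_frame_norm U).
  have sumc (c : R) : \sum_(i < m) c = m%:R * c.
    by rewrite sumr_const card_ord -[LHS]mulr_natl.
  by rewrite !sumc; move: m%:R (symp_frame_norm U) => a w; ring.
apply: le_trans (ler_norm_sum _ _ _) _; apply: ler_sum => i _.
rewrite normrM hE; apply: ler_pM => //.
rewrite symp_mulmxr big_split_ord/= big_ord1 lastC symp_hcenterr mulr0 addr0.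
apply: le_trans (ler_norm_sum _ _ _) _; apply: ler_sum => j _.
by rewrite normrM hE; apply: ler_pM => //; rewrite !rowC.
Qed.

Lemma popp_integralE (M : sr_metric R n) (U : (m + 1).-tuple H) (F : set H)
    (G0 : subgroup R n) :
  adapted_frame M U -> fundamental_domain G0 F ->
  (`|popp_integral U F| = `|\det (invmx (central_frame U))|%:E *
    lebesgueN R (m + 1) (@row_of_tuple R (m + 1) @^-1` F) *
    (symp_frame_norm U)^-1%:E)%E.
Proof.
move=> aU [mF _].
rewrite /popp_integral; under eq_integral do rewrite (popp_densityE aU).
rewrite -(popp_densityE aU 0) integral_cst// abseM abse_EFin.
rewrite (popp_density_norm aU) (gee0_abs (measure_ge0 _ _)).
by rewrite EFinM muleAC.
Qed.

Lemma bounded_adapted_basis (G0 : lattice R n) (M : sr_metric R n) (D V : R) :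
  (1 <= n)%N -> 0 < D -> 0 < V ->
  bracket_generating M -> corank M = 1%N -> (sr_diam M G0 <= D%:E)%E ->
  (V%:E <= popp_measure M G0)%E ->
  exists G z N, adapted_basis G0 G z N /\
    forall i j, `|(N i j)%:~R| <= code_bound n D V.
Proof.
move=> n1 D0 V0 gM cM dD mV.
have /ereal_sup_gt[_ [U [F [aU fF ->]]] UV] : ((V / 2)%:E < popp_measure M G0)%E.
  by apply: lt_le_trans mV; rewrite lte_fin; lra.
pose B := invmx (central_frame U).
have uB : B \in unitmx by rewrite unitmx_inv (central_frame_unit gM cM aU).
have ZB : Z *m B = Z := central_frame_center gM cM aU.
have BM v j : v \in sr_space M -> (v *m B) 0 (lshift 1 j) ^+ 2 <= sr_ip M v v.
  exact: (central_frame_coord gM cM aU).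
have l0 : 0 < D + 1 by lra.
have cov := diameter_cover ZB BM dD.
have [G [z [N [ab GL]]]] := exists_adapted_basis (@lattice_discrete _ _ G0)
  uB ZB (ltW l0) cov n1.
exists G, z, N; split => // i j.
have z0 := ab_gt0 ab.
have L0 : 0 <= 2 * (D + 1) + 1 by lra.
rewrite -(ler_pM2r z0) -{1}(gtr0_norm z0) -normrM -(ab_symp ab).
pose W := (2 * Num.sqrt (m + 1)%:R : R) ^+ (m + 1) * (D + 1) ^+ m.
have W0 : 0 <= W.
  by rewrite mulr_ge0 ?exprn_ge0 ?mulr_ge0 ?sqrtr_ge0// ltW.
have Wz0 : 0 <= W * z * (2 / V).
  apply: mulr_ge0; first exact: mulr_ge0 W0 (ltW z0).
  by rewrite divr_ge0// ltW.
have om : symp_frame_norm U <= W * z * (2 / V).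
  have om0 : 0 <= symp_frame_norm U by exact: sqrtr_ge0.
  move: UV; rewrite (popp_integralE aU fF) => UV.
  have vol := fundamental_domain_volume_le ab uB ZB l0 cov fF.
  have : ((V / 2)%:E < (W * z / symp_frame_norm U)%:E)%E.
    apply: (lt_le_trans UV); rewrite [leRHS]EFinM; apply: lee_wpmul2r vol.
    by rewrite lee_fin invr_ge0.
  rewrite lte_fin; have [->|omn0] := eqVneq (symp_frame_norm U) 0.
    by move=> _.
  have omgt0 : 0 < symp_frame_norm U by rewrite lt_neqAle eq_sym omn0.
  rewrite ltr_pdivlMr// => /ltW h.
  by rewrite mulrA ler_pdivlMr//; lra.
have CE : code_bound n D V * z =
    (2 * (D + 1) + 1) ^+ 2 * m%:R ^+ 2 * (W * z * (2 / V)).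
  by rewrite /code_bound /W; ring.
have rhs0 : 0 <= code_bound n D V * z.
  rewrite CE; apply: mulr_ge0; first by rewrite mulr_ge0 ?exprn_ge0.
  exact: Wz0.
case: (split_ordP i) => a ->; last first.
  by rewrite ord1 (ab_last ab) sympZl symp_hcenterl mulr0 normr0.
case: (split_ordP j) => b ->; last first.
  by rewrite ord1 (ab_last ab) sympZr symp_hcenterr mulr0 normr0.
apply: le_trans (symp_le_frame_norm gM cM aU L0 (GL a) (GL b)) _.
rewrite CE ler_wpM2l// mulr_ge0 ?exprn_ge0//.
Qed.

(** An integer matrix with entries in [-b, b], shifted to be indexed by a finite
    type. *)
Definition decode_mx k (b : nat) (A : 'M['I_b.*2.+1]_k) : 'M[int]_k :=
  \matrix_(i, j) ((A i j : nat)%:Z - b%:Z).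

Lemma decode_mx_surj k (b : nat) (N : 'M[int]_k) :
  (forall i j, `|N i j| <= b%:Z) -> exists A, decode_mx (b := b) A = N.
Proof.
move=> Nb; exists (\matrix_(i, j) inord `|(N i j + b%:Z)%R|%N).
apply/matrixP => i j; rewrite !mxE.
have := Nb i j; rewrite ler_norml => /andP[h1 h2].
have h0 : 0 <= N i j + b%:Z by lra.
rewrite inordK ?gez0_abs ?addrK//.
rewrite ltnS -lez_nat gez0_abs// -addnn PoszD; lra.
Qed.

(** A common multiple of the denominators [2 |det N|] of the grids, over all the
    nonsingular [N] with entries in [-b, b]: the codes then live in one finite
    type. *)
Definition grid_order k (b : nat) : nat :=
  \prod_(A : 'M['I_b.*2.+1]_(k + 1))
    (if \det (ulsubmx (decode_mx A)) == 0 then 1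
     else 2 * `|\det (ulsubmx (decode_mx A))|)%N.

Lemma grid_order_gt0 k b : (0 < grid_order k b)%N.
Proof.
apply: prodn_gt0 => A; case: ifPn => // d0.
by rewrite muln_gt0 absz_gt0 d0.
Qed.

Lemma dvdn_grid_order k b (A : 'M['I_b.*2.+1]_(k + 1)) :
  \det (ulsubmx (decode_mx A)) != 0 ->
  (2 * `|\det (ulsubmx (decode_mx A))| %| grid_order k b)%N.
Proof.
by move=> d0; rewrite /grid_order (bigD1 A)//= (negPf d0) dvdn_mulr.
Qed.

Definition has_code (b : nat) (G0 : lattice R n)
    (t : 'M['I_b.*2.+1]_(m + 1) *
      {set {ffun 'I_(m + 1) -> 'I_((grid_order m b).*2).+1}}) :=
  exists G z, adapted_basis G0 G z (decode_mx t.1) /\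
    lattice_code G0 G (grid_order m b) = t.2.

Lemma same_code_diffeo_class b (G0 G1 : lattice R n) t :
  has_code (b := b) G0 t -> has_code (b := b) G1 t ->
  diffeo_class G0 = diffeo_class G1.
Proof.
move=> [G [z [ab c0]]] [G' [z' [ab' c1]]].
have dq := dvdn_grid_order (ab_det ab).
have [P uP [PM PG]] := same_code_isomorphic ab ab' (grid_order_gt0 m b) dq
  (etrans c0 (esym c1)).
exact: diffeo_class_eq uP PM PG.
Qed.

End Finiteness.

Theorem proposition1p3 (R : realType) (n : nat) (hn : (1 <= n)%N)
    (D V : R) (hD : 0 < D) (hV : 0 < V) :
  finite_set [set diffeo_class Gamma | Gamma in
    [set Gamma : lattice R n | exists M : sr_metric R n,
      [/\ bracket_generating M, corank M = 1%N,
          (sr_diam M Gamma <= D%:E)%E &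
          (V%:E <= popp_measure M Gamma)%E]]].
Proof.
pose b := `|Num.ceil (code_bound n D V)|%N.
pose T := ('M['I_b.*2.+1]_(n + n + 1) *
  {set {ffun 'I_(n + n + 1) -> 'I_((grid_order (n + n) b).*2).+1}})%type.
pose cl (t : T) : set (lattice R n) :=
  if pselect (exists G0, has_code G0 t) is left e then diffeo_class (sval (cid e))
  else set0.
apply: (@sub_finite_set _ _ (cl @` [set: T])); last exact/finite_image/finite_finset.
move=> _ [G0 [M [gM cM dD mV]] <-].
have [G [z [N [ab Nb]]]] := bounded_adapted_basis hn hD hV gM cM dD mV.
have [A AN] : exists A, decode_mx (b := b) A = N.
  apply: decode_mx_surj => i j; rewrite -(ler_int R) intr_norm.
  apply: le_trans (Nb i j) _; apply: le_trans (Num.Theory.ceil_ge _) _.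
  by rewrite ler_int /b abszE ler_norm.
pose t : T := (A, lattice_code G0 G (grid_order (n + n) b)).
have ct : has_code G0 t by exists G, z; rewrite /= AN.
exists t => //; rewrite /cl; case: pselect => [e|]; last by case; exists G0.
exact: same_code_diffeo_class (svalP (cid e)) ct.
Qed.
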